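(* Let $n\ge 3$, let $g$ be a (nondegenerate) metric of indefinite signature on $\mathbb{R}^n$, and let $\Gamma=(\Gamma^i_{jk})$ be a symmetric linear connection on $\mathbb{R}^n$. Suppose that the projective structure $[\Gamma]$ and the conformal structure $[g]$ are light cone compatible. Then there exist $1$-forms $\varphi=(\varphi_i)$ and $\eta=(\eta_i)$ on $\mathbb{R}^n$ such that $$\Gamma^{i}_{jk} = F^i_{jk} + \varphi^i g_{jk} + \eta_j \delta^i_k + \eta_k \delta^i_j ,$$ where $F=(F^i_{jk})$ denotes the Levi-Civita connection of $g$ and $\varphi^i=g^{ij}\varphi_j$.
   Context: Manifolds and maps are smooth, of class at least $C^2$. A conformal structure on a manifold is an equivalence class $[g]$ of metric tensors, where $g\sim g'$ if and only if $g'=e^{2f}g$ for some function $f$. Geodesics are considered without preferred parametrization: a geodesic of a symmetric linear connection $\Gamma$ is a curve $\gamma$ with $\nabla^{\Gamma}_{\dot\gamma}\dot\gamma$ proportional to $\dot\gamma$ (also called an autoparallel curve). Two symmetric (torsion-free) linear connections are projectively equivalent if their geodesics in this sense coincide; equivalently $\Gamma'^i_{jk}=\Gamma^i_{jk}+\delta^i_j\psi_k+\delta^i_k\psi_j$ for some $1$-form $\psi$. A projective structure $[\Gamma]$ is an equivalence class with respect to this relation. A light-like geodesic of $g$ is a geodesic of the Levi-Civita connection of $g$ whose tangent vectors satisfy $g(\dot\gamma,\dot\gamma)=0$. A projective structure $[\Gamma]$ and a conformal structure $[g]$ are called light cone compatible if every light-like geodesic of $g$ is a geodesic (autoparallel curve)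 of $\Gamma$. This condition does not depend on the choice of the representative $\Gamma$ of the projective structure nor of the representative $g$ of the conformal structure. *)

(* Defs.v *)
From HB Require Import structures.
From mathcomp Require Import all_boot all_order all_algebra.
From mathcomp Require Import all_classical all_reals all_analysis.
From mathcomp Require Import lra.

Set Implicit Arguments.
Unset Strict Implicit.
Unset Printing Implicit Defensive.

Import Order.TTheory GRing.Theory Num.Theory.
Import numFieldNormedType.Exports.

Local Open Scope classical_set_scope.
Local Open Scope ring_scope.

Section Definitions.
Context {R : realType} {n : nat}.

(* All tensor fields are given by their components in the standard global
   coordinates of R^n, whose points are the row vectors 'rV[R]_n. *)

Definition partial (i : 'I_n) (f : 'rV[R]_n -> R) : 'rV[R]_n -> R :=
  fun x => 'D_(delta_mx 0 i) f x.

Fixpoint of_class_C (k : nat) (f : 'rV[R]_n -> R) : Prop :=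
  continuous f /\
  if k is k'.+1 then
    forall i : 'I_n,
      (forall x, derivable f x (delta_mx 0 i)) /\ of_class_C k' (partial i f)
  else True.

(* A smoothness degree is [Some k] for C^k and [None] for C^oo. *)
Definition smooth (r : option nat) (f : 'rV[R]_n -> R) : Prop :=
  if r is Some k then of_class_C k f else forall k, of_class_C k f.

Definition metric (g : 'rV[R]_n -> 'M[R]_n) : Prop :=
  forall x, (g x)^T = g x /\ g x \in unitmx.

Definition signature_mx (p : nat) : 'M[R]_n :=
  diag_mx (\row_(i < n) (if (i < p)%N then 1 else -1)).

(* [A] is the Gram matrix of a form of signature (p, n - p): some basis (the
   rows of [P]) is orthogonal with p squares 1 followed by n - p squares -1. *)
Definition has_signature (p : nat) (A : 'M[R]_n) : Prop :=
  exists2 P : 'M[R]_n, P \in unitmx & P *m A *m P^T = signature_mx p.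

Definition indefinite_signature (g : 'rV[R]_n -> 'M[R]_n) : Prop :=
  exists2 p : nat, (0 < p < n)%N & forall x, has_signature p (g x).

Definition inner (g : 'rV[R]_n -> 'M[R]_n) (x u v : 'rV[R]_n) : R :=
  (u *m g x *m v^T) 0 0.

(* [G x i j k] is the coefficient of upper index i and lower indices j, k. *)
Definition connection : Type := 'rV[R]_n -> 'I_n -> 'M[R]_n.

Definition symmetric_connection (G : connection) : Prop :=
  forall x i, (G x i)^T = G x i.

Definition levi_civita (g : 'rV[R]_n -> 'M[R]_n) : connection :=
  fun x i => \matrix_(j, k)
    (2^-1 * \sum_l invmx (g x) i l *
       (partial j (fun y => g y l k) x + partial k (fun y => g y l j) x
        - partial l (fun y => g y j k) x)).

Lemma levi_civitaP (g : 'rV[R]_n -> 'M[R]_n) (G : connection) :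
  metric g ->
  (symmetric_connection G /\
   forall x i j k, partial k (fun y => g y i j) x =
     \sum_l G x l k i * g x l j + \sum_l G x l k j * g x i l)
  <-> G = levi_civita g.
Proof.
move=> mg; have gC y i j : g y i j = g y j i.
  by have [/matrixP/(_ j i)] := mg y; rewrite mxE.
have dgC k i j : partial k (fun y => g y i j) = partial k (fun y => g y j i).
  by congr partial; apply/funext => y.
pose S x m j k := partial j (fun y => g y m k) x
  + partial k (fun y => g y m j) x - partial m (fun y => g y j k) x.
have lower x m j k :
    \sum_l levi_civita g x l j k * g x m l = 2^-1 * S x m j k.
  under eq_bigr => l _ do rewrite mxE -mulrA big_distrl/=.
  rewrite -mulr_sumr exchange_big/=; congr (_ * _).
  rewrite (bigD1 m)//= [X in _ + X]big1 => [|a am].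
    rewrite addr0; under eq_bigr => l _ do rewrite mulrAC [_ * g x m l]mulrC.
    rewrite -mulr_suml; have [_ /mulmxV/matrixP/(_ m m)] := mg x.
    by rewrite !mxE eqxx => ->; rewrite mul1r.
  under eq_bigr => l _ do rewrite mulrAC [_ * g x m l]mulrC.
  rewrite -mulr_suml; have [_ /mulmxV/matrixP/(_ m a)] := mg x.
  by rewrite !mxE eq_sym (negbTE am) => ->; rewrite mul0r.
split=> [[Gsym Gg]|->]; last first.
  split=> [x i|x i j k].
    apply/matrixP => j k; rewrite !mxE; congr (_ * _); apply: eq_bigr => l _.
    by rewrite (dgC l k j) [X in _ * (X - _)]addrC.
  under eq_bigr => l _ do rewrite gC.
  rewrite !lower /S (dgC i j k) (dgC j i k) (dgC k j i); lra.
have GC x l j k : G x l j k = G x l k j.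
  by have /matrixP/(_ k j) := Gsym x l; rewrite mxE.
have GS x m j k : \sum_l G x l j k * g x m l = 2^-1 * S x m j k.
  rewrite /S !Gg.
  have sC a b c : \sum_l G x l a b * g x l c = \sum_l G x l a b * g x c l.
    by apply: eq_bigr => l _; rewrite gC.
  have tC a b c : \sum_l G x l a b * g x c l = \sum_l G x l b a * g x c l.
    by apply: eq_bigr => l _; rewrite GC.
  rewrite !sC (tC k j m) (tC m j k) (tC m k j); lra.
apply/funext => x; apply/funext => i; apply/matrixP => j k.
have [_ gu] := mg x.
have /(congr1 (mulmx (invmx (g x)))) : g x *m (\col_l G x l j k) =
    g x *m (\col_l levi_civita g x l j k).
  apply/colP => m; rewrite !mxE.
  transitivity (2^-1 * S x m j k); [rewrite -GS|rewrite -lower].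
    by apply: eq_bigr => l _; rewrite mulrC; congr (_ * _); rewrite [LHS]mxE.
  by apply: eq_bigr => l _; rewrite mulrC; congr (_ * _); rewrite [RHS]mxE.
by rewrite !mulKmx// => /colP/(_ i); rewrite [LHS]mxE [RHS]mxE.
Qed.

(* The components of nabla_{c'} c' along the curve [c]. *)
Definition acceleration (G : connection) (c : R -> 'rV[R]_n) (t : R) :
    'rV[R]_n :=
  derive1 (derive1 c) t +
  \row_i \sum_j \sum_k G (c t) i j k * derive1 c t 0 j * derive1 c t 0 k.

(* A regular C^2 curve on an open interval; values of [c] outside of [I] are
   irrelevant. *)
Definition regular_curve (I : set R) (c : R -> 'rV[R]_n) : Prop :=
  [/\ open I, is_interval I, I !=set0 &
      forall t, I t ->
        [/\ derivable c t 1, derivable (derive1 c) t 1,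
            {for t, continuous (derive1 (derive1 c))} & derive1 c t != 0]].

(* Geodesics carry no preferred parametrization. *)
Definition geodesic (G : connection) (I : set R) (c : R -> 'rV[R]_n) : Prop :=
  regular_curve I c /\
  exists a : R -> R, forall t, I t -> acceleration G c t = a t *: derive1 c t.

Definition lightlike_geodesic (g : 'rV[R]_n -> 'M[R]_n) (I : set R)
    (c : R -> 'rV[R]_n) : Prop :=
  geodesic (levi_civita g) I c /\
  forall t, I t -> inner g (c t) (derive1 c t) (derive1 c t) = 0.

(* Compatibility of the projective structure of [G] with the conformal
   structure of [g], expressed on representatives: the condition is independent
   of their choice. *)
Definition light_cone_compatible (G : connection) (g : 'rV[R]_n -> 'M[R]_n) :
    Prop :=
  forall I c, lightlike_geodesic g I c -> geodesic G I c.

Definition raise (g : 'rV[R]_n -> 'M[R]_n) (phi : 'rV[R]_n -> 'rV[R]_n)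
    (x : 'rV[R]_n) (i : 'I_n) : R :=
  \sum_j invmx (g x) i j * phi x 0 j.

End Definitions.

Arguments connection : clear implicits.

(* Main.v *)
Require Import Defs.
From mathcomp Require Import all_boot all_order all_algebra.
From mathcomp Require Import all_classical all_reals all_analysis.
From mathcomp Require Import ring lra.
Import Order.TTheory GRing.Theory Num.Theory.
Import numFieldNormedType.Exports.
Local Open Scope ring_scope.

(* For a null vector v at x, the equation of g-geodesics has a C^1 right-hand
   side, so Picard iteration gives a solution starting at x with velocity v.
   Metric compatibility keeps g(c', c') constant, hence the solution is a
   light-like geodesic, and compatibility makes it a Gamma-geodesic. Comparing the
   two accelerations at time 0 shows that D = Gamma - F satisfies
   D(v, v) = a(v) v for every null v.
   In a basis that diagonalizes g, testing this on the null vectors e_a +- e_b and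
   3 e_a +- 4 e_a' +- 5 e_b determines the components of D and gives
   D^i_jk = phi^i g_jk + eta_j delta^i_k + eta_k delta^i_j at each point.
   Finally phi and eta are as smooth as Gamma, because the two traces
   D^i_ik = phi_k + (n+1) eta_k  and  g_ki g^ab D^i_ab = n phi_k + 2 eta_k
   can be solved for them (the determinant is, up to sign, (n+2)(n-1)). *)

Set Implicit Arguments.
Unset Strict Implicit.

(** * Quadratic maps preserving the directions of a null cone *)

Section NullConeAlgebra.
Variables (R : realFieldType) (n : nat).

Definition quad (A : 'M[R]_n) (w : 'I_n -> R) : R :=
  \sum_j \sum_k A j k * w j * w k.

Definition triple (a b c : 'I_n) (x y z : R) (i : 'I_n) : R :=
  x * (i == a)%:R + y * (i == b)%:R + z * (i == c)%:R.

Lemma sum_delta (a : 'I_n) (f : 'I_n -> R) : \sum_i f i * (i == a)%:R = f a.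
Proof.
rewrite (bigD1 a)//= eqxx mulr1 big1 ?addr0// => i /negbTE ->.
by rewrite mulr0.
Qed.

Lemma sum_triple a b c x y z (f : 'I_n -> R) :
  \sum_i f i * triple a b c x y z i = x * f a + y * f b + z * f c.
Proof.
rewrite -(sum_delta a f) -(sum_delta b f) -(sum_delta c f) !mulr_sumr.
rewrite -!big_split/=; apply: eq_bigr => i _; rewrite /triple; ring.
Qed.

Lemma quad_triple (A : 'M[R]_n) a b c x y z : A^T = A ->
  quad A (triple a b c x y z) =
  x ^+ 2 * A a a + y ^+ 2 * A b b + z ^+ 2 * A c c +
  2 * (x * y * A a b + x * z * A a c + y * z * A b c).
Proof.
move=> AT; have AC i j : A i j = A j i.
  by have /matrixP/(_ i j) := AT; rewrite mxE => ->.
rewrite /quad; under eq_bigr => j _ do rewrite sum_triple.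
transitivity (\sum_j (x * A j a + y * A j b + z * A j c) * triple a b c x y z j).
  by apply: eq_bigr => j _; ring.
rewrite sum_triple (AC b a) (AC c a) (AC c b); ring.
Qed.

(** * Pointwise algebra in an orthogonal basis *)

Section Diagonal.
Variables (e : 'I_n -> R) (o : 'I_n -> 'I_n) (E : 'I_n -> 'M[R]_n).
Hypothesis e_sign : forall i, e i = 1 \/ e i = -1.
Hypothesis e_opp : forall i, e (o i) = - e i.
Hypothesis E_sym : forall i, (E i)^T = E i.
(** Proportionality of [E] on [(w, w)] to [w], cross-multiplied so that no factor has to be
    named. *)
Hypothesis E_null : forall w : 'I_n -> R, \sum_i e i * w i ^+ 2 = 0 ->
  forall i j, w j * quad (E i) w = w i * quad (E j) w.

Let EC i j k : E i j k = E i k j.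
Proof. by have /matrixP/(_ j k) := E_sym i; rewrite mxE => ->. Qed.

Let sqrN1 : (-1) ^+ 2 = 1 :> R.
Proof. by rewrite sqrrN expr1n. Qed.

Let wedge a b c x y z i j : x ^+ 2 * e a + y ^+ 2 * e b + z ^+ 2 * e c = 0 ->
    a != b -> a != c -> b != c ->
  triple a b c x y z j * (x ^+ 2 * E i a a + y ^+ 2 * E i b b + z ^+ 2 * E i c c +
    2 * (x * y * E i a b + x * z * E i a c + y * z * E i b c)) =
  triple a b c x y z i * (x ^+ 2 * E j a a + y ^+ 2 * E j b b + z ^+ 2 * E j c c +
    2 * (x * y * E j a b + x * z * E j a c + y * z * E j b c)).
Proof.
move=> exyz ab ac bc; rewrite -!quad_triple//; apply: E_null.
under eq_bigr => i0 _ do rewrite expr2 mulrA.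
rewrite sum_triple /triple !eqxx.
rewrite (eq_sym b a) (eq_sym c a) (eq_sym c b).
by rewrite (negbTE ab) (negbTE ac) (negbTE bc) -[RHS]exyz /=; ring.
Qed.

Let wedge2 a b s i j : e b = - e a -> s ^+ 2 = 1 ->
  ((j == a)%:R + s * (j == b)%:R) * (E i a a + E i b b + 2 * s * E i a b) =
  ((i == a)%:R + s * (i == b)%:R) * (E j a a + E j b b + 2 * s * E j a b).
Proof.
move=> eab s1.
have ab : a != b.
  by apply/eqP => ab; move: eab; rewrite -ab; case: (e_sign a) => ->; lra.
(* The null vector e_a + s e_b; the third slot is a filler of weight 0. *)
have := @E_null (triple a b b 1 s 0) _ i j.
rewrite !quad_triple// /triple !mul0r !addr0 !mul1r s1 !mul1r expr1n.
rewrite expr0n/= !(mul0r, mulr0, addr0, mul1r, mulrA); apply.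
transitivity (\sum_i0 e i0 * triple a b b 1 s 0 i0 * triple a b b 1 s 0 i0).
  by apply: eq_bigr => k _; rewrite /triple; ring.
rewrite sum_triple /triple !eqxx (eq_sym b a) (negbTE ab) eab.
rewrite /= !(mulr0, mulr1, addr0, add0r, mul0r). 
by rewrite mul1r mulNr mulrN mulrCA -expr2 s1 mulr1 subrr.
Qed.

Let opp_neq a b : e b = - e a -> a != b.
Proof.
move=> eab; apply/eqP => ab; move: eab; rewrite -ab.
by case: (e_sign a) => ->; lra.
Qed.

(** On e_a + e_b and e_a - e_b the component [i] must vanish, since these vectors have no component
    along [i]. Sum and difference of the two conditions separate the diagonal part from the mixed
    one. *)
Let opp_off a b i : e b = - e a -> i != a -> i != b ->
  E i a a = - E i b b /\ E i a b = 0.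
Proof.
move=> eab ia ib; have ab := opp_neq eab.
have := @wedge2 a b 1 i a eab (expr1n R 2).
have := @wedge2 a b (-1) i a eab sqrN1.
by rewrite eqxx (negbTE ab) (negbTE ia) (negbTE ib) /=; lra.
Qed.

(** The components along [a] and [b] must agree up to the sign [s]; subtracting the conditions for s
    = 1 and s = -1 leaves this relation. *)
Let opp_on a b : e b = - e a -> E a a a + E a b b = 2 * E b a b.
Proof.
move=> eab; have ab := opp_neq eab.
have := @wedge2 a b 1 a b eab (expr1n R 2).
have := @wedge2 a b (-1) a b eab sqrN1.
by rewrite !eqxx (eq_sym b a) (negbTE ab) /=; lra.
Qed.

Let same_neq a a' b : e a' = e a -> e b = - e a -> a' != a ->
  [/\ a != a', a != b & a' != b].
Proof.
move=> eaa' eab a'a; split; first by rewrite eq_sym.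
  exact: opp_neq.
by apply: opp_neq; rewrite eaa'.
Qed.

(* 3^2 + 4^2 = 5^2 makes [3 s e_a + 4 s' e_a' + 5 e_b] null, without square roots. *)
Let null345 a a' b s s' : e a' = e a -> e b = - e a ->
  s ^+ 2 = 1 -> s' ^+ 2 = 1 ->
  (3 * s) ^+ 2 * e a + (4 * s') ^+ 2 * e a' + 5 ^+ 2 * e b = 0.
Proof. by move=> -> -> s1 s'1; rewrite !exprMn s1 s'1; lra. Qed.

(** In the condition on 3 s e_a + 4 e_a' + 5 e_b, flipping [s] changes only the mixed terms with
    [a]. Those with [b] vanish by [opp_off], which isolates [E i a a']. *)
Let same_off a a' b i : e a' = e a -> e b = - e a -> a' != a ->
  i != a -> i != a' -> i != b -> E i a a' = 0.
Proof.
move=> eaa' eab a'a ia ia' ib.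
have [naa' nab na'b] := same_neq eaa' eab a'a.
have [_ ab0] := opp_off eab ia ib.
have [_ a'b0] := opp_off (etrans eab (congr1 -%R (esym eaa'))) ia' ib.
have Ps := expr1n R 2.
have := @wedge a a' b _ _ _ i b (null345 eaa' eab Ps Ps) naa' nab na'b.
have := @wedge a a' b _ _ _ i b (null345 eaa' eab sqrN1 Ps) naa' nab na'b.
rewrite /triple !eqxx (negbTE ia) (negbTE ia') (negbTE ib).
rewrite (eq_sym b a) (eq_sym b a') (negbTE nab) (negbTE na'b) ab0 a'b0 /=.
lra.
Qed.

(** The four sign choices in (3, 4, 5), tested on the component pairs [(a, b)] and [(a, a')], give
    eight linear equations. Together with the relations for pairs of opposite sign they imply the
    four equalities. *)
Let same_on a a' b : e a' = e a -> e b = - e a -> a' != a ->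
  [/\ E b a a = E b a' a', E b a a' = 0, E a a a' = E b a' b &
      E a a b = E a' a' b].
Proof.
move=> eaa' eab a'a.
have [naa' nab na'b] := same_neq eaa' eab a'a.
have ea'b := etrans eab (congr1 -%R (esym eaa')).
have [a'1 a'2] := opp_off ea'b naa' nab.
have [a1 a2] := opp_off eab a'a na'b.
have eba : e a = - e b by rewrite eab opprK.
have b1 := opp_on eba; rewrite (EC a b a) in b1.
have Ps := expr1n R 2.
have Npp := null345 eaa' eab Ps Ps.
have Nnp := null345 eaa' eab sqrN1 Ps.
have Npn := null345 eaa' eab Ps sqrN1.
have Nnn := null345 eaa' eab sqrN1 sqrN1.
have W i j := conj (@wedge a a' b _ _ _ i j Npp naa' nab na'b)
  (conj (@wedge a a' b _ _ _ i j Nnp naa' nab na'b)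
  (conj (@wedge a a' b _ _ _ i j Npn naa' nab na'b)
        (@wedge a a' b _ _ _ i j Nnn naa' nab na'b))).
have := W a b; have := W a a'.
rewrite /triple !eqxx (eq_sym b a) (eq_sym b a') (eq_sym a' a).
rewrite (negbTE naa') (negbTE nab) (negbTE na'b) a2 a'2 /=.
move=> {W} [A1 [A2 [A3 A4]]] [B1 [B2 [B3 B4]]].
by clear Npp Nnp Npn Nnn; split; lra.
Qed.

(** The claimed shape leaves one value for every pattern of equal indices among [i], [j], [k]; the
    preceding relations show that each component depends on its pattern in this way. *)
Lemma null_cone_diag : exists phi eta : 'I_n -> R, forall i j k,
  E i j k = phi i * (e j * (j == k)%:R) + eta j * (i == k)%:R + eta k * (i == j)%:R.
Proof.
(* The witnesses are read off from the claimed formula at the index [o i], which differs from [i]: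
   [E i (o i) (o i)] has to be [phi i * e (o i)], and [E (o i) i (o i)] has to be [eta i]. *)
exists (fun i => e (o i) * E i (o i) (o i)), (fun i => E (o i) i (o i)) => i j k.
have e2 a : e a * e a = 1 by case: (e_sign a) => ->; rewrite ?mulrNN mulr1.
have e_eq a b : e a = e b \/ e b = - e a.
  by case: (e_sign a) => ->; case: (e_sign b) => ->; rewrite ?opprK; tauto.
have diag_off a b : b != a -> E a b b = e b * (e (o a) * E a (o a) (o a)).
  move=> ba; have eoa := e_opp a; have [eab|eab] := e_eq a b.
    have ebo : e (o a) = - e b by rewrite eoa eab.
    have ao := opp_neq eoa.
    rewrite eq_sym in ba.
    have [-> _] := opp_off ebo ba ao.
    by rewrite mulrA ebo mulrN e2 mulN1r.
  have ebo : e (o a) = e b by rewrite eoa eab.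
  have eba : e a = - e b by rewrite eab opprK.
  rewrite ebo mulrA e2 mul1r.
  have [->//|/(same_on ebo eba)[]//] := eqVneq (o a) b.
have mixed a b : b != a -> E b a b = E (o a) a (o a).
  move=> ba; have eoa := e_opp a; have [eab|eab] := e_eq a b.
    rewrite (EC b).
    have eob : e (o a) = - e b by rewrite eoa eab.
    by have [|_ _ -> _] := same_on eab eob; rewrite 1?eq_sym.
  have eoab : e b = e (o a) by rewrite eoa eab.
  have eao : e a = - e (o a) by rewrite eoa opprK.
  rewrite (EC b) (EC (o a)).
  by have [->//|/(same_on eoab eao)[]] := eqVneq b (o a).
have [<-|jk] := eqVneq j k.
  have [<-|ij] := eqVneq i j.
    have eoi := e_opp i; have := opp_on eoi.
    have := e2 i; rewrite eoi; case: (e_sign i) => -> _ /=; lra.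
  by rewrite diag_off 1?eq_sym//=; lra.
have [ij|ij] := eqVneq i j.
  subst j; rewrite (negbTE jk) EC mixed//=; lra.
have [ik|ik] := eqVneq i k; first by subst k; rewrite mixed//=; lra.
(* Three distinct indices. When [j] and [k] have the same sign, [o j] supplies the third index of a
   null vector; it may coincide with [i], which is the case covered by [same_on]. *)
suff -> : E i j k = 0 by rewrite /=; lra.
have [ejk|ejk] := e_eq j k; last by have [] := opp_off ejk ij ik.
have eoj := e_opp j.
have kj : k != j by rewrite eq_sym.
have [->|ioj] := eqVneq i (o j).
  by have [] := same_on (esym ejk) eoj kj.
exact: (same_off (esym ejk) eoj kj ij ik ioj).
Qed.

End Diagonal.
End NullConeAlgebra.

(** * From the orthogonal basis back to standard coordinates *)

Section Transport.
Variables (R : realType) (n : nat).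

Lemma quadE (A : 'M[R]_n) (w : 'rV[R]_n) :
  (w *m A *m w^T) 0 0 = quad A (fun i => w 0 i).
Proof.
rewrite mxE /quad exchange_big/=; apply: eq_bigr => k _.
rewrite mxE mulr_suml; apply: eq_bigr => j _; rewrite !mxE; ring.
Qed.

Lemma null_cone (M : 'M[R]_n) (D : 'I_n -> 'M[R]_n) (p : nat) :
    (0 < p < n)%N -> has_signature p M -> (forall i, (D i)^T = D i) ->
    (forall v : 'rV[R]_n, (v *m M *m v^T) 0 0 = 0 -> forall i j,
      v 0 j * (v *m D i *m v^T) 0 0 = v 0 i * (v *m D j *m v^T) 0 0) ->
  exists phi eta : 'I_n -> R, forall i j k,
    D i j k = phi i * M j k + eta j * (i == k)%:R + eta k * (i == j)%:R.
Proof.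
move=> /andP[p0 pn] [P uP PMP] Dsym Dnull.
pose Q := invmx P.
pose e (i : 'I_n) : R := if (i < p)%N then 1 else -1.
have n0 : (0 < n)%N by exact: leq_trans pn.
have ltn1 : (n.-1 < n)%N by rewrite prednK.
(* As 0 < p < n, index 0 carries the sign 1 and index n - 1 the sign -1. *)
pose o (i : 'I_n) := if (i < p)%N then Ordinal ltn1 else Ordinal n0.
(* The components of [D] in the basis given by the rows of [P]: the lower indices are transformed by
   [P], the upper one by its inverse. *)
pose E c : 'M[R]_n := \sum_i Q i c *: (P *m D i *m P^T).
have e_opp i : e (o i) = - e i.
  rewrite /e /o; case: (boolP (i < p)%N) => ip /=; last by rewrite p0 opprK.
  by rewrite ltnNge -ltnS prednK// pn.
have e_sign i : e i = 1 \/ e i = -1 by rewrite /e; case: ifP; tauto.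
have E_sym c : (E c)^T = E c.
  rewrite /E linear_sum/=; apply: eq_bigr => i _.
  by rewrite linearZ/= !trmx_mul trmxK Dsym mulmxA.
have QP : Q *m P = 1%:M by rewrite mulVmx.
have PQ : P *m Q = 1%:M by rewrite mulmxV.
have E_null (w : 'I_n -> R) : \sum_i e i * w i ^+ 2 = 0 ->
    forall c d, w d * quad (E c) w = w c * quad (E d) w.
  move=> w0 c d.
  pose r : 'rV[R]_n := \row_i w i; pose v := r *m P.
  have quadr A : quad A w = (r *m A *m r^T) 0 0.
    by rewrite quadE; congr quad; apply/funext => i; rewrite mxE.
  have vM : (v *m M *m v^T) 0 0 = 0.
    rewrite -[RHS]w0 /v trmx_mul.
    have -> : r *m P *m M *m (P^T *m r^T) = r *m (P *m M *m P^T) *m r^T.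
      by rewrite !mulmxA.
    rewrite PMP /signature_mx mul_mx_diag mxE; apply: eq_bigr => i _.
    by rewrite !mxE /e; ring.
  have quadEc a : quad (E a) w = \sum_i Q i a * (v *m D i *m v^T) 0 0.
    rewrite quadr /E mulmx_sumr mulmx_suml summxE; apply: eq_bigr => i _.
    by rewrite -scalemxAr -scalemxAl mxE /v trmx_mul !mulmxA.
  have wE a : w a = \sum_j v 0 j * Q j a.
    have : r = v *m Q by rewrite /v -mulmxA PQ mulmx1.
    by move=> /rowP/(_ a); rewrite !mxE.
  rewrite !quadEc !wE !mulr_suml ; under eq_bigr => i _ do rewrite mulr_sumr.
  under [RHS]eq_bigr => i _ do rewrite mulr_sumr.
  rewrite [RHS]exchange_big/=; apply: eq_bigr => j _; apply: eq_bigr => i _.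
  transitivity (Q j d * Q i c * (v 0 j * (v *m D i *m v^T) 0 0)); first ring.
  rewrite (Dnull _ vM); ring.
have [phi [eta Ephi]] := null_cone_diag e_sign e_opp E_sym E_null.
pose h : 'cV[R]_n := \col_a eta a.
exists (fun i => \sum_c P c i * phi c), (fun i => (Q *m h) i 0) => i j k.
have S : signature_mx p = P *m M *m P^T by rewrite PMP.
have sumQP l m : \sum_c Q l c * P c m = (l == m)%:R.
  by have /matrixP/(_ l m) := QP; rewrite !mxE.
have DE : P *m D i *m P^T = \sum_c P c i *: E c.
  rewrite /E; under eq_bigr => c _ do rewrite scaler_sumr.
  rewrite exchange_big /= (bigD1 i)//= [X in _ + X]big1 => [|l li].
    under eq_bigr => c _ do rewrite scalerA mulrC.
    by rewrite -scaler_suml sumQP eqxx scale1r addr0.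
  under eq_bigr => c _ do rewrite scalerA mulrC.
  by rewrite -scaler_suml sumQP (negbTE li) scale0r.
(* Halfway back: the upper index is standard again, the lower ones still refer to the basis [P]. The
   two eta terms become matrices of rank at most one. *)
have PDP : P *m D i *m P^T = (\sum_c P c i * phi c) *: (P *m M *m P^T) +
    h *m (col i P)^T + col i P *m h^T.
  rewrite DE -S; apply/matrixP => a b; rewrite summxE !mxE !big_ord1 !mxE.
  under eq_bigr => c _ do rewrite mxE Ephi !mulrDr.
  rewrite !big_split/= mulr_suml; congr (_ + _ + _).
  - by apply: eq_bigr => c _; rewrite /e; case: (a == b) => /=; ring.
  - under eq_bigr => c _ do rewrite mulrA.
    by rewrite (sum_delta b (fun c => P c i * eta a)) mulrC.
  - under eq_bigr => c _ do rewrite mulrA.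
    by rewrite (sum_delta a (fun c => P c i * eta b)).
have DQ : D i = Q *m (P *m D i *m P^T) *m Q^T.
  by rewrite !mulmxA QP mul1mx -mulmxA -trmx_mul QP trmx1 mulmx1.
have Qcol : Q *m col i P = delta_mx i 0.
  apply/colP => l; rewrite !mxE andbT -sumQP; apply: eq_bigr => c _.
  by rewrite mxE.
rewrite {1}DQ PDP !mulmxDr !mulmxDl -scalemxAr -scalemxAl.
have -> : Q *m (P *m M *m P^T) *m Q^T = M.
  by rewrite !mulmxA QP mul1mx -mulmxA -trmx_mul QP trmx1 mulmx1.
have -> : Q *m (h *m (col i P)^T) *m Q^T = Q *m h *m (Q *m col i P)^T.
  by rewrite trmx_mul !mulmxA.
have -> : Q *m (col i P *m h^T) *m Q^T = Q *m col i P *m (Q *m h)^T.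
  by rewrite trmx_mul !mulmxA.
rewrite Qcol !(mxE, big_ord1) !eqxx !andbT (eq_sym k) (eq_sym j).
by congr (_ + _ + _); rewrite mulrC.
Qed.
End Transport.

(** * Functions of class C^k *)

Section Smoothness.
Variables (R : realType) (n : nat).
Implicit Types (f g : 'rV[R]_n -> R) (k : nat).

Lemma of_class_C_continuous k f : of_class_C k f -> continuous f.
Proof. by case: k => [|k] []. Qed.

Lemma of_class_CS k f : of_class_C k.+1 f -> of_class_C k f.
Proof.
elim: k f => [|k IH] f [cf df]; first by [].
by split=> // i; have [dfi /IH] := df i.
Qed.

Lemma of_class_C_cst k (a : R) : of_class_C k (fun _ : 'rV[R]_n => a).
Proof.
elim: k a => [|k IH] a; first by split=> //; exact: cst_continuous.
split=> [|i]; first exact: cst_continuous.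
split=> [x|]; first exact: derivable_cst.
rewrite (_ : partial i _ = fun=> 0); first exact: IH.
by apply/funext => x; rewrite /partial derive_cst.
Qed.

Lemma of_class_CD k f g :
  of_class_C k f -> of_class_C k g -> of_class_C k (fun x => f x + g x).
Proof.
elim: k f g => [|k IH] f g [cf df] [cg dg].
  by split=> // x; exact: continuousD (cf x) (cg x).
split=> [x|i]; first exact: continuousD (cf x) (cg x).
have [dfi cfi] := df i; have [dgi cgi] := dg i.
split=> [x|]; first exact: derivableD.
rewrite (_ : partial i _ = fun x => partial i f x + partial i g x).
  exact: IH.
by apply/funext => x; rewrite /partial -deriveD.
Qed.

Lemma of_class_CM k f g :
  of_class_C k f -> of_class_C k g -> of_class_C k (fun x => f x * g x).
Proof.
elim: k f g => [|k IH] f g Cf Cg; have [cf df] := Cf; have [cg dg] := Cg.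
  by split=> // x; exact: continuousM (cf x) (cg x).
split=> [x|i]; first exact: continuousM (cf x) (cg x).
have [dfi cfi] := df i; have [dgi cgi] := dg i.
split=> [x|]; first exact: derivableM.
rewrite (_ : partial i _ = fun x => f x * partial i g x + g x * partial i f x).
  by apply: of_class_CD; apply: IH => //; exact: of_class_CS.
apply/funext => x; rewrite /partial.
by rewrite (_ : (fun _ => _) = f * g)// deriveM.
Qed.

Lemma of_class_CN k f : of_class_C k f -> of_class_C k (fun x => - f x).
Proof.
move=> Cf; rewrite (_ : (fun _ => _) = fun x => -1 * f x).
  exact: of_class_CM (of_class_C_cst _ _) Cf.
by apply/funext => x; rewrite mulN1r.
Qed.

Lemma of_class_CV k f : (forall x, f x != 0) ->
  of_class_C k f -> of_class_C k (fun x => (f x)^-1).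
Proof.
move=> f0; elim: k => [|k IH] Cf; have [cf df] := Cf.
  by split=> // x; exact: continuousV (f0 x) (cf x).
split=> [x|i]; first exact: continuousV (f0 x) (cf x).
have [dfi cfi] := df i.
split=> [x|]; first exact: derivableV.
rewrite (_ : partial i _ = fun x => - ((f x)^-1 * (f x)^-1 * partial i f x)).
  apply: of_class_CN; apply: of_class_CM => //.
  by apply: of_class_CM; apply: IH; exact: of_class_CS.
apply/funext => x; rewrite /partial deriveV// -exprVn expr2.
by rewrite scaleNr.
Qed.

Lemma of_class_C_sum k (I : Type) (s : seq I) (P : pred I)
    (F : I -> 'rV[R]_n -> R) :
  (forall i, P i -> of_class_C k (F i)) ->
  of_class_C k (fun x => \sum_(i <- s | P i) F i x).
Proof.
move=> CF; elim: s => [|i s IH].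
  under eq_fun do rewrite big_nil; exact: of_class_C_cst.
under eq_fun do rewrite big_cons.
by case: (boolP (P i)) => [Pi|//]; apply: of_class_CD => //; exact: CF.
Qed.

Lemma of_class_C_prod k (I : Type) (s : seq I) (P : pred I)
    (F : I -> 'rV[R]_n -> R) :
  (forall i, P i -> of_class_C k (F i)) ->
  of_class_C k (fun x => \prod_(i <- s | P i) F i x).
Proof.
move=> CF; elim: s => [|i s IH].
  under eq_fun do rewrite big_nil; exact: of_class_C_cst.
under eq_fun do rewrite big_cons.
by case: (boolP (P i)) => [Pi|//]; apply: of_class_CM => //; exact: CF.
Qed.

Lemma of_class_C_det k m (A : 'rV[R]_n -> 'M[R]_m) :
  (forall i j, of_class_C k (fun x => A x i j)) ->
  of_class_C k (fun x => \det (A x)).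
Proof.
move=> CA; apply: of_class_C_sum => s _.
apply: of_class_CM; first exact: of_class_C_cst.
by apply: of_class_C_prod => i _; exact: CA.
Qed.

(** By Cramer's rule the entries are cofactors divided by the determinant, which has no zero. *)
Lemma of_class_C_invmx k m (A : 'rV[R]_n -> 'M[R]_m) :
  (forall x, A x \in unitmx) ->
  (forall i j, of_class_C k (fun x => A x i j)) ->
  forall i j, of_class_C k (fun x => invmx (A x) i j).
Proof.
move=> uA CA i j.
rewrite (_ : (fun _ => _) = fun x => (\det (A x))^-1 * cofactor (A x) j i).
  apply: of_class_CM.
    apply: of_class_CV; last exact: of_class_C_det.
    by move=> x; have := uA x; rewrite unitmxE unitfE.
  apply: of_class_CM; first exact: of_class_C_cst.
  apply: of_class_C_det => a b.
  by under eq_fun do rewrite !mxE; exact: CA.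
by apply/funext => x; rewrite /invmx uA !mxE.
Qed.

End Smoothness.

(** * Regularity of the Christoffel symbols *)

Section LeviCivitaSmooth.
Variables (R : realType) (n : nat) (g : 'rV[R]_n -> 'M[R]_n).

Lemma of_class_C_levi_civita k : metric g ->
  (forall i j, of_class_C k.+1 (fun x => g x i j)) ->
  forall i j l, of_class_C k (fun x => levi_civita g x i j l).
Proof.
move=> mg Cg i j l.
have Cgi : forall a b, of_class_C k (fun x => invmx (g x) a b).
  apply: of_class_C_invmx => [x|a b]; first by have [] := mg x.
  exact: of_class_CS.
have Cdg a b c : of_class_C k (partial a (fun x => g x b c)).
  by have [_ /(_ a)[]] := Cg b c.
under eq_fun do rewrite mxE.
apply: of_class_CM; first exact: of_class_C_cst.
apply: of_class_C_sum => a _; apply: of_class_CM => //.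
by apply: of_class_CD; [exact: of_class_CD|exact: of_class_CN].
Qed.

Lemma smooth_levi_civita (r : option nat) : metric g ->
  (forall i j, smooth (omap succn r) (fun x => g x i j)) ->
  forall i j l, smooth r (fun x => levi_civita g x i j l).
Proof.
case: r => [k|] mg /= Cg i j l; first exact: of_class_C_levi_civita.
by move=> k; apply: of_class_C_levi_civita => // a b; exact: Cg.
Qed.

End LeviCivitaSmooth.

Lemma smooth_of_class_C1 (R : realType) n (r : option nat)
    (f : 'rV[R]_n -> R) :
  r != Some 0%N -> smooth r f -> of_class_C 1 f.
Proof.
case: r => [[|k]//|] _; last exact.
by rewrite /smooth; elim: k => [//|k IH] /of_class_CS; exact: IH.
Qed.

(** * The Picard-Lindeloef theorem *)

Section Primitive.
Variable R : realType.
Local Open Scope classical_set_scope.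
Local Open Scope ring_scope.
Implicit Types h k : R -> R.

(* The base point -2 lies below every time used: the solutions live on [-1, 1]. *)
Definition primitive h (t : R) : R :=
  parameterized_integral lebesgue_measure (-2) t h -
  parameterized_integral lebesgue_measure (-2) 0 h.

Lemma primitive0 h : primitive h 0 = 0.
Proof. exact: subrr. Qed.

Lemma is_derive_primitive h (t : R) :
  continuous h -> -2 < t < 2 -> is_derive t (1 : R) (primitive h) (h t).
Proof.
move=> ch /andP[t1 t2].
have int_h : lebesgue_measure.-integrable `[-2, 2 : R]%classic (EFin \o h).
  apply: continuous_compact_integrable; first exact: segment_compact.
  exact: continuous_subspaceT.
have [d1 d2] := continuous_FTC1_closed t2 int_h t1 (ch t).
have D : is_derive t (1 : R)
    (fun x => parameterized_integral lebesgue_measure (-2) x h) (h t).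
  by split; [exact: d1|rewrite -derive1E; exact: d2].
by apply: is_derive_eq; rewrite subr0.
Qed.

(** The mean value inequality, applied on either side of 0. It gives the contraction estimate for
    primitives and, with B = 0, the constancy of a function with zero derivative. *)
Lemma norm_le_derive_bound (f df : R -> R) (T B t : R) :
  (forall s, -T <= s <= T -> is_derive s (1 : R) f (df s)) ->
  (forall s, -T <= s <= T -> `|df s| <= B) -> f 0 = 0 -> -T <= t <= T ->
  `|f t| <= T * B.
Proof.
move=> fd dB f0 /andP[t1 t2].
have T0 : 0 <= T by lra.
have B0 : 0 <= B by apply: le_trans (dB 0 _) => //; lra.
have cf a b : -T <= a -> b <= T -> {within `[a, b]%classic, continuous f}.
  move=> aT bT; apply: derivable_within_continuous => x; rewrite in_itv/= => /andP[x1 x2].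
  by have [] := fd x; first lra.
have step a b : -T <= a -> b <= T -> a <= b -> `|f b - f a| <= (b - a) * B.
  move=> aT bT ab.
  have fdab x : x \in `]a, b[ -> is_derive x (1 : R) f (df x).
    by rewrite in_itv/= => /andP[x1 x2]; apply: fd; lra.
  have [c] := MVT_segment ab fdab (cf _ _ aT bT).
  rewrite in_itv/= => /andP[c1 c2] ->.
  rewrite normrM mulrC (@ger0_norm _ (b - a)) ?subr_ge0//.
  apply: ler_wpM2l; first by rewrite subr_ge0.
  by apply: dB; lra.
have [t0|t0] := leP 0 t.
  have := step 0 t; rewrite f0 !subr0 => H.
  apply: (le_trans (H _ _ _)) => //; first lra.
  exact: ler_wpM2r.
have := step t 0; rewrite f0 !sub0r normrN => H.
apply: (le_trans (H _ _ _)) => //; first exact: ltW.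
apply: ler_wpM2r => //; lra.
Qed.

Lemma primitive_dist h k (T e t : R) : continuous h -> continuous k ->
  (forall s, `|h s - k s| <= e) -> T < 2 -> -T <= t <= T ->
  `|primitive h t - primitive k t| <= T * e.
Proof.
move=> ch ck hk T2 tT.
apply: (@norm_le_derive_bound (fun t => primitive h t - primitive k t)
  (fun t => h t - k t)) tT => [s /andP[s1 s2]|s _|]; last 2 first.
- exact: hk.
- by rewrite !primitive0 subrr.
have dh : is_derive s (1 : R) (primitive h) (h s).
  by apply: is_derive_primitive => //; lra.
have dk : is_derive s (1 : R) (primitive k) (k s).
  by apply: is_derive_primitive => //; lra.
exact: is_deriveB.
Qed.

End Primitive.

(** * Truncation to an interval *)

Section Clamp.
Variable R : realType.
Local Open Scope classical_set_scope.
Local Open Scope ring_scope.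

(** For r >= 0, the nearest-point projection onto [a - r, a + r]. Composing with it extends data
    from an interval to the whole line without increasing Lipschitz constants. *)
Definition clamp (a r t : R) : R := Num.max (a - r) (Num.min (a + r) t).

Lemma clamp_id a r t : `|t - a| <= r -> clamp a r t = t.
Proof.
rewrite ler_distl => /andP[t1 t2]; rewrite /clamp.
by rewrite (min_idPr _)// (max_idPr _).
Qed.

Lemma clamp_dist a r t : 0 <= r -> `|clamp a r t - a| <= r.
Proof.
move=> r0; rewrite ler_distl /clamp le_max lexx /= ge_max ge_min lexx /=.
by rewrite andbT; lra.
Qed.

Lemma clamp_lip a r s t : `|clamp a r s - clamp a r t| <= `|s - t|.
Proof.
wlog st : s t / s <= t.
  move=> H; have [/H//|/ltW/H] := leP s t.
  by rewrite distrC (distrC t).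
rewrite !(distrC _ t) !(distrC _ (clamp a r t)) (@ger0_norm _ (t - s)); last by rewrite subr_ge0.
rewrite /clamp ler_norml; apply/andP; split;
  rewrite /Num.max /Num.min; do 4! case: ifPn; rewrite -?leNgt; lra.
Qed.

Lemma clamp_continuous a r : continuous (clamp a r).
Proof.
move=> t; apply/cvgrPdist_le => e e0.
near=> s; apply: le_trans (clamp_lip _ _ _ _) _.
near: s; exact: cvgr_dist_le.
Unshelve. all: by end_near. Qed.

End Clamp.

(** * Picard iteration for a globally Lipschitz system *)

Section Picard.
Local Open Scope classical_set_scope.
Local Open Scope ring_scope.
Variable R : realType.

(** With [b k] the sum of the remaining bounds, the intervals [a k - b k, a k + b k] are nested. The
    supremum of their left ends lies in all of them. *)
Lemma geometric_limit (a : nat -> R) (C : R) :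
  (forall k, `|a k.+1 - a k| <= C / 2 ^+ k) ->
  exists l, forall k, `|a k - l| <= 2 * C / 2 ^+ k.
Proof.
move=> aC.
pose b k := 2 * C / 2 ^+ k.
have bS k : C / 2 ^+ k = b k - b k.+1.
  rewrite /b exprS; have : (2 : R) ^+ k != 0 by rewrite expf_neq0.
  by move=> ?; field.
have lo k m : a k - b k <= a (k + m)%N - b (k + m)%N.
  elim: m => [|m IH]; first by rewrite addn0.
  apply: (le_trans IH); rewrite addnS.
  by have := aC (k + m)%N; rewrite bS ler_norml => /andP[]; lra.
have hi k m : a (k + m)%N + b (k + m)%N <= a k + b k.
  elim: m => [|m IH]; first by rewrite addn0.
  apply: le_trans IH; rewrite addnS.
  by have := aC (k + m)%N; rewrite bS ler_norml => /andP[]; lra.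
have b0 k : 0 <= b k.
  rewrite /b; have := le_trans (normr_ge0 _) (aC 0%N).
  rewrite expr0 divr1 => C0.
  by rewrite divr_ge0 ?mulr_ge0// exprn_ge0.
pose S : set R := range (fun k => a k - b k).
have ubS k : ubound S (a k + b k).
  move=> _ [m _ <-].
  have := lo m k; have := hi k m; rewrite addnC; have := b0 (m + k)%N; lra.
have supS : has_sup S.
  by split; [exists (a 0%N - b 0%N); exists 0%N|exists (a 0%N + b 0%N)].
exists (sup S) => k; rewrite -/(b k) distrC ler_distl; apply/andP; split.
  by apply: ub_le_sup; [case: supS|exists k].
by apply: ge_sup; [case: supS|exact: ubS].
Qed.

Variables (K : finType) (f : (K -> R) -> K -> R) (L : R).
Hypothesis L_ge0 : 0 <= L.
Hypothesis f_lip : forall (p q : K -> R) (d : R), (forall j, `|p j - q j| <= d) ->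
  forall j, `|f p j - f q j| <= L * d.

Lemma lip_continuous (u : R -> K -> R) :
  (forall j, continuous (fun t => u t j)) ->
  forall j, continuous (fun t => f (u t) j).
Proof.
have L1 : 0 < L + 1 by rewrite ltr_wpDl.
move=> cu j t; apply/cvgrPdist_le => e e0.
near=> s.
(* Dividing by L + 1 instead of L covers L = 0. *)
apply: (@le_trans _ _ (L * (e / (L + 1)))).
  apply: f_lip; near: s; apply: filter_forall => i.
  by apply: cvgr_dist_le; [exact: cu|exact: divr_gt0].
rewrite mulrCA ger_pMr// ler_pdivrMr// mul1r lerDl.
Unshelve. all: by end_near. Qed.

Variable p0 : K -> R.

Lemma picard_lindelof : exists2 T : R, 0 < T & exists u : R -> K -> R,
  [/\ u 0 = p0, forall j, continuous (fun t => u t j) &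
      forall (t : R) j, -T < t < T ->
        is_derive t (1 : R) (fun s => u s j) (f (u t) j)].
Proof.
have L0 := L_ge0.
(* [T * L <= 1 / 2] makes the Picard step a contraction of ratio 1 / 2. *)
pose T : R := (2 * (L + 1))^-1.
have T0 : 0 < T by rewrite invr_gt0; lra.
have TL : T * L <= 2^-1.
  rewrite /T invfM -mulrA ger_pMr ?invr_gt0//.
  by rewrite mulrC ler_pdivrMr ?mul1r; lra.
have T1 : T <= 1 by rewrite /T invf_le1 ?mulr_gt0//; lra.
pose cl := clamp 0 T.
have clT t : -T <= cl t <= T.
  by have := clamp_dist 0 t (ltW T0); rewrite subr0 ler_norml.
have cl_continuous : continuous cl by exact: clamp_continuous.
have cl_id (t : R) : -T <= t <= T -> cl t = t.
  by move=> tT; apply: clamp_id; rewrite subr0 ler_norml.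
exists T => //.
(* The Picard operator at clamped time: its values are frozen outside [-T, T], so the iterates are
   continuous on the whole line and all estimates are uniform in [t]. *)
pose step (u : R -> K -> R) : R -> K -> R :=
  fun t j => p0 j + primitive (fun s => f (u s) j) (cl t).
have step_continuous u : (forall j, continuous (fun t => u t j)) ->
    forall j, continuous (fun t => step u t j).
  move=> cu j t; apply: cvgD; first exact: cvg_cst.
  apply: (@continuous_comp _ _ _ cl (primitive (fun s => f (u s) j))).
    exact: cl_continuous.
  apply/differentiable_continuous/derivable1_diffP.
  have [] // := @is_derive_primitive _ _ (cl t) (@lip_continuous u cu j).
  by have := clT t; lra.
have step_dist u w d : (forall j, continuous (fun t => u t j)) ->
    (forall j, continuous (fun t => w t j)) ->
    (forall t j, `|u t j - w t j| <= d) ->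
    forall t j, `|step u t j - step w t j| <= 2^-1 * d.
  move=> cu cw uw t j.
  have d0 : 0 <= d by apply: le_trans (uw 0 j).
  rewrite /step opprD addrACA subrr add0r.
  apply: (@le_trans _ _ (T * (L * d))).
    apply: primitive_dist (clT t); [exact: lip_continuous|exact: lip_continuous| |lra].
    by move=> s; apply: f_lip => i; exact: uw.
  by rewrite mulrA ler_wpM2r.
pose U k := iter k step (fun _ => p0).
have U_continuous k j : continuous (fun t => U k t j).
  elim: k j => [|k IH] j; first exact: cst_continuous.
  exact: step_continuous.
(* The first step moves coordinate [j] by at most [T * |f p0 j|], hence by at most [C] because T <=
   1; each later step is at most half the previous bound. *)
pose C : R := \sum_j `|f p0 j|.
have U_dist k t j : `|U k.+1 t j - U k t j| <= C / 2 ^+ k.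
  elim: k t j => [|k IH] t j.
    rewrite expr0 divr1 /= /step addrAC subrr add0r.
    apply: (@le_trans _ _ (T * `|f p0 j|)).
      apply: (@norm_le_derive_bound _ _ (fun=> f p0 j)) (clT t) => // [s sT|].
        by apply: is_derive_primitive; [exact: cst_continuous|lra].
      exact: primitive0.
    apply: (@le_trans _ _ `|f p0 j|); first exact: ler_piMl.
    by rewrite /C (bigD1 j)//= lerDl sumr_ge0.
  have := step_dist _ _ _ (U_continuous k.+1) (U_continuous k) IH t j.
  by rewrite exprS invfM mulrCA.
have lim_ex t j := cid (geometric_limit (fun k => U_dist k t j)).
pose u t j := sval (lim_ex t j).
have Uu k t j : `|U k t j - u t j| <= 2 * C / 2 ^+ k := svalP (lim_ex t j) k.
have small (e : R) : 0 < e -> exists k, 2 * C / 2 ^+ k <= e.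
  (* For this k, 2 ^ k > k > 2 C / e. *)
  move=> e0; exists (Num.truncn (2 * C / e)).+1.
  rewrite ler_pdivrMr ?exprn_gt0// [e * _]mulrC -ler_pdivrMr//.
  apply: (le_trans (ltW (truncnS_gt _))).
  by rewrite -natrX ler_nat ltnW// ltn_expl.
have u_continuous j : continuous (fun t => u t j).
  move=> t; apply/cvgrPdist_le => e e0.
  have e3 : 0 < e / 3 := divr_gt0 e0 (ltr0Sn _ 2).
  have [k Ck] := small _ e3.
  near=> s.
  have : `|U k t j - U k s j| <= e / 3.
    near: s; have /cvgrPdist_le := U_continuous k j t.
    exact.
  have := Uu k t j; have := Uu k s j.
  by move: Ck; rewrite !ler_norml; lra.
  Unshelve. all: end_near.
(* Both sides are close to the iterate k + 1: the left one by convergence, the right one because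
   [step] halves the distance between [U k] and [u]. *)
have u_fix t j : u t j = step u t j.
  apply/eqP; rewrite -subr_eq0 -normr_le0; apply/ler_addgt0Pr => e e0.
  have [k Ck] := small (e / 2) (divr_gt0 e0 (ltr0Sn _ 1)).
  have := step_dist _ _ _ (U_continuous k) u_continuous (Uu k) t j.
  have := Uu k.+1 t j.
  have -> : 2 * C / 2 ^+ k.+1 = 2^-1 * (2 * C / 2 ^+ k).
    by rewrite exprS invfM mulrCA.
  have -> : U k.+1 t j = step (U k) t j by [].
  by move: Ck; rewrite add0r !ler_norml; lra.
exists u; split => //.
- apply/funext => j; rewrite u_fix /step cl_id; last lra.
  by rewrite primitive0 addr0.
- move=> t j tT.
  have D : is_derive t (1 : R) (primitive (fun s => f (u s) j)) (f (u t) j).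
    apply: (is_derive_primitive (@lip_continuous u u_continuous j)).
    lra.
  apply: (@near_eq_is_derive _ _ _
    (fun s => p0 j + primitive (fun s => f (u s) j) s)).
    near=> s; rewrite [RHS]u_fix /step cl_id//.
    have : s \in `]-T, T[.
      by near: s; apply: near_in_itvoo; rewrite in_itv/=; case/andP: tT => -> ->.
    by rewrite in_itv/= => /andP[/ltW -> /ltW ->].
  by rewrite -[f (u t) j]add0r; apply: is_deriveD.
Unshelve. all: by end_near. Qed.

End Picard.

(** * Mean value theorem and chain rule in coordinates *)

Section CoordinateCalculus.
Local Open Scope classical_set_scope.
Local Open Scope ring_scope.
Variables (R : realType) (n : nat).
Implicit Types (h : 'rV[R]_n -> R) (x y p q v : 'rV[R]_n).

Lemma cvg_row (T : Type) (F : set_system T) {FF : Filter F} m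
    (f : T -> 'rV[R]_m) (l : 'rV[R]_m) :
  (forall j, (fun t => f t 0 j) @ F --> l 0 j) -> f @ F --> l.
Proof.
move=> fl; apply/cvgrPdist_lt => e e0.
near=> t; rewrite -[ltLHS]/(mx_norm _) mx_normrE; apply/bigmax_ltP; split=> // -[i j] _.
rewrite /= !mxE ord1; move: j; near: t; apply: filter_forall => j.
by have /cvgrPdist_lt := fl j; exact.
Unshelve. all: by end_near. Qed.

Lemma cvg_sum_ord (T : Type) (F : set_system T) {FF : Filter F} m
    (f : 'I_m -> T -> R) (l : 'I_m -> R) :
  (forall j, f j @ F --> l j) ->
  (fun t => \sum_j f j t) @ F --> \sum_j l j.
Proof.
move=> fl; elim: (index_enum _) => [|i s IH].
  by under eq_fun do rewrite big_nil; rewrite big_nil; exact: cvg_cst.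
by under eq_fun do rewrite big_cons; rewrite big_cons; exact: cvgD.
Qed.

(** The two difference quotients coincide, so one-variable calculus applies along lines. *)
Lemma is_derive_line h x v (t : R) : (forall y, derivable h y v) ->
  is_derive t (1 : R) (fun s => h (s *: v + x)) ('D_v h (t *: v + x)).
Proof.
move=> dh; have E : (fun e : R => e^-1 *: (((fun s => h (s *: v + x)) \o shift t) (e *: 1) -
    h (t *: v + x))) =
  (fun e : R => e^-1 *: ((h \o shift (t *: v + x)) (e *: v) - h (t *: v + x))).
  by apply/funext => e /=; rewrite scalerDl addrA [e *: 1]mulr1.
by split; [rewrite /derivable E; exact: dh|rewrite /derive E].
Qed.

Lemma MVT_line h x v (a : R) : (forall y, derivable h y v) ->
  exists2 c : R, `|c| <= `|a| & h (a *: v + x) - h x = 'D_v h (c *: v + x) * a.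
Proof.
move=> dh; pose f (s : R) := h (s *: v + x).
have fd s : is_derive s (1 : R) f ('D_v h (s *: v + x)) by exact: is_derive_line.
have cf (b c : R) : {within `[b, c], continuous f}.
  by apply: derivable_within_continuous => s _; have [] := fd s.
have f0 : h x = f 0 by rewrite /f scale0r add0r.
rewrite f0 -/(f a).
have [a0|a0] := leP 0 a.
  have [c] := MVT_segment a0 (fun s _ => fd s) (cf _ _).
  rewrite in_itv/= subr0 => /andP[c0 ca] ->; exists c => //.
  by rewrite !ger0_norm.
have [c] := MVT_segment (ltW a0) (fun s _ => fd s) (cf _ _).
rewrite in_itv/= sub0r => /andP[c0 ca] E; exists c.
  by rewrite !ler0_norm ?lerN2// ltW.
by rewrite -[LHS]opprB E mulrN opprK.
Qed.

(** Walk from [p] to [q] changing one coordinate at a time, apply the mean value theorem on each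
    edge, and telescope. Only partial derivatives enter, in keeping with the definition of
    [of_class_C]. *)
Lemma mean_value_coord h p q : (forall (i : 'I_n) y, derivable h y (delta_mx 0 i)) ->
  exists2 xi : 'I_n -> 'rV[R]_n,
    (forall k j, `|xi k 0 j - p 0 j| <= `|q 0 j - p 0 j|) &
    h q - h p = \sum_k partial k h (xi k) * (q 0 k - p 0 k).
Proof.
move=> dh.
pose P (m : nat) : 'rV[R]_n := \row_j (if (j < m)%N then q 0 j else p 0 j).
have P0 : P 0%N = p by apply/rowP => j; rewrite mxE.
have Pn : P n = q by apply/rowP => j; rewrite mxE ltn_ord.
have PS (k : 'I_n) : P k.+1 = (q 0 k - p 0 k) *: delta_mx 0 k + P k.
  apply/rowP => j; rewrite !mxE eqxx /= ltnS leq_eqVlt.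
  have [->|jk] := eqVneq j k; first by rewrite eqxx ltnn mulr1 subrK.
  by rewrite (_ : (j == k :> nat) = false) ?mulr0 ?add0r//; exact/negbTE.
have ex_c (k : 'I_n) := MVT_line (P k) (q 0 k - p 0 k) (dh k).
pose c k := sval (cid2 (ex_c k)).
have cle k : `|c k| <= `|q 0 k - p 0 k| by rewrite /c; case: cid2.
have cE (k : 'I_n) : h (P k.+1) - h (P k) =
    partial k h (c k *: delta_mx 0 k + P k) * (q 0 k - p 0 k).
  by rewrite PS /c /partial; case: cid2.
exists (fun k : 'I_n => c k *: delta_mx 0 k + P k) => [k j|].
  rewrite !mxE eqxx /=.
  have [->|jk] := eqVneq j k; first by rewrite ltnn mulr1 addrK.
  by rewrite mulr0 add0r; case: ifP => // _; rewrite subrr normr0.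
rewrite -[in LHS]Pn -[in LHS]P0.
under eq_bigr => k _ do rewrite -cE.
rewrite -(big_mkord predT (fun k => h (P k.+1) - h (P k))).
by rewrite telescope_sumr.
Qed.

(** By [mean_value_coord], the difference quotient is a sum of partial derivatives at intermediate
    points times difference quotients of the coordinates. The intermediate points are squeezed to
    [c t], where the partial derivatives are continuous. *)
Lemma chain_rule h (c : R -> 'rV[R]_n) (t : R) (c' : 'I_n -> R) :
  of_class_C 1 h ->
  (forall k, is_derive t (1 : R) (fun s => c s 0 k) (c' k)) ->
  is_derive t (1 : R) (fun s => h (c s)) (\sum_k partial k h (c t) * c' k).
Proof.
move=> [_ Ch] dc.
have dh (i : 'I_n) y : derivable h y (delta_mx 0 i) by have [] := Ch i.
have cdh (i : 'I_n) : continuous (partial i h) by have [_ []] := Ch i.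
have ex_xi s := mean_value_coord (c t) (c s) dh.
pose xi s := sval (cid2 (ex_xi s)).
have xi_le s k j : `|xi s k 0 j - c t 0 j| <= `|c s 0 j - c t 0 j|.
  by rewrite /xi; case: cid2.
have xiE s : h (c s) - h (c t) = \sum_k partial k h (xi s k) * (c s 0 k - c t 0 k).
  by rewrite /xi; case: cid2.
have cc k : {for t, continuous (fun s => c s 0 k)}.
  by apply/differentiable_continuous/derivable1_diffP; have [] := dc k.
have xi_cvg k : (fun s => xi s k) @ t --> c t.
  apply: cvg_row => j; apply/cvgrPdist_le => e e0.
  near=> s; rewrite distrC; apply: (le_trans (xi_le _ _ _)); rewrite distrC.
  by near: s; have /cvgrPdist_le := cc j; exact.
have L : (fun e : R => e^-1 *: (((fun s => h (c s)) \o shift t) (e *: 1) - h (c t)))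
    @ 0^' --> \sum_k partial k h (c t) * c' k.
  rewrite (_ : (fun _ => _) = (fun e => \sum_k partial k h (xi (e + t) k) *
      (e^-1 *: (((fun s => c s 0 k) \o shift t) (e *: 1) - c t 0 k)))); last first.
    apply/funext => e /=; rewrite xiE scaler_sumr; apply: eq_bigr => k _.
    by rewrite [e *: 1]mulr1 /GRing.scale /=; ring.
  apply: cvg_sum_ord => k; apply: cvgM.
    have cv : (fun e => xi (e + t) k) @ 0^' --> c t.
      have et : (fun e : R => e + t) @ 0^' --> t.
        rewrite -[X in _ --> X]add0r; apply: cvgD; last exact: cvg_cst.
        exact: cvg_within.
      exact: (cvg_comp (fun e : R => e + t) (xi^~ k) et (xi_cvg k)).
    exact: (continuous_cvg _ (cdh k (c t)) cv).
  have [+ <-] := dc k.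
  exact.
split; first by apply/cvg_ex; eexists; exact: L.
by apply: cvg_lim L.
Unshelve. all: by end_near. Qed.
End CoordinateCalculus.

(** * Geodesics with given initial data *)

Section BoundedLipschitz.
Local Open Scope classical_set_scope.
Local Open Scope ring_scope.
Variables (R : realType) (n : nat).

Lemma box_bounded (h : 'rV[R]_n -> R) (x0 : 'rV[R]_n) (r : R) : continuous h ->
  exists2 M : R, 0 <= M &
    forall y : 'rV[R]_n, (forall j, `|y 0 j - x0 0 j| <= r) -> `|h y| <= M.
Proof.
move=> ch.
pose A := [set y : 'rV[R]_n | forall j, `[x0 0 j - r, x0 0 j + r]%classic (y 0 j)].
have cA : compact A.
  apply: (@rV_compact _ _ (fun j => `[x0 0 j - r, x0 0 j + r]%classic)) => j.
  exact: segment_compact.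
have inA (y : 'rV[R]_n) : (forall j, `|y 0 j - x0 0 j| <= r) -> A y.
  by move=> yr j; rewrite /= in_itv/= -ler_distl.
(* An empty box has no point to bound, so M = 0 does. *)
have [A0|] := pselect (A !=set0); last first.
  by move=> A0; exists 0 => // y /inA Ay; exfalso; apply: A0; exists y.
have [|c Ac cmax] := EVT_max_rV A0 cA (f := fun y => `|h y|).
  by apply: continuous_subspaceT => y; exact: (continuous_comp (ch y) (@norm_continuous _ _ (h y))).
by exists `|h c| => // y /inA Ay; apply: cmax; rewrite inE.
Qed.

Variable K : finType.
Implicit Types (f : (K -> R) -> R).

(** Boundedness accompanies the Lipschitz condition to make the class stable under products.
    Distances are taken in the maximum norm, as in the Picard iteration. *)
Definition bounded_lipschitz f := exists M : R, [/\ 0 <= M,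
  forall p, `|f p| <= M &
  forall p q (d : R), 0 <= d -> (forall j, `|p j - q j| <= d) ->
    `|f p - f q| <= M * d].

Lemma bounded_lipschitz_cst (a : R) : bounded_lipschitz (fun=> a).
Proof. by exists `|a|; split=> // p q d d0 _; rewrite subrr normr0 mulr_ge0. Qed.

Lemma bounded_lipschitzD f g : bounded_lipschitz f -> bounded_lipschitz g ->
  bounded_lipschitz (fun p => f p + g p).
Proof.
move=> [M [M0 fM fl]] [N [N0 gN gl]]; exists (M + N); split.
- exact: addr_ge0.
- by move=> p; apply: le_trans (ler_normD _ _) _; exact: lerD.
- move=> p q d d0 pq; rewrite opprD addrACA mulrDl.
  by apply: le_trans (ler_normD _ _) _; apply: lerD; [exact: fl|exact: gl].
Qed.

Lemma bounded_lipschitzM f g : bounded_lipschitz f -> bounded_lipschitz g ->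
  bounded_lipschitz (fun p => f p * g p).
Proof.
move=> [M [M0 fM fl]] [N [N0 gN gl]]; exists (2 * M * N + M * N); split.
- by rewrite addr_ge0 ?mulr_ge0.
- move=> p; rewrite normrM; apply: (@le_trans _ _ (M * N)); first exact: ler_pM.
  by rewrite lerDr !mulr_ge0.
- move=> p q d d0 pq.
  have -> : f p * g p - f q * g q = (f p - f q) * g p + f q * (g p - g q) by ring.
  apply: le_trans (ler_normD _ _) _; rewrite !normrM.
  have H1 : `|f p - f q| * `|g p| <= (M * d) * N by apply: ler_pM => //; exact: fl.
  have H2 : `|f q| * `|g p - g q| <= M * (N * d) by apply: ler_pM => //; exact: gl.
  have H3 : 0 <= M * N * d by rewrite !mulr_ge0.
  lra.
Qed.

Lemma bounded_lipschitz_sum m (f : 'I_m -> (K -> R) -> R) :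
  (forall i, bounded_lipschitz (f i)) ->
  bounded_lipschitz (fun p => \sum_i f i p).
Proof.
move=> fl; elim: (index_enum _) => [|i s IH].
  by under eq_fun do rewrite big_nil; exact: bounded_lipschitz_cst.
by under eq_fun do rewrite big_cons; exact: bounded_lipschitzD.
Qed.

Lemma bounded_lipschitz_clamp (a : R) (j : K) :
  bounded_lipschitz (fun p => clamp a 1 (p j)).
Proof.
exists (`|a| + 1); split=> [|p|p q d d0 pq].
- exact: addr_ge0.
- rewrite -(subrK a (clamp a 1 (p j))) [leRHS]addrC.
  by apply: le_trans (ler_normD _ _) _; rewrite lerD2r clamp_dist.
- apply: le_trans (clamp_lip _ _ _ _) _; apply: le_trans (pq j) _.
  by rewrite ler_peMl// lerDr.
Qed.

(* Clamping the arguments to a box turns local Lipschitz bounds into global ones,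
   as [picard_lindelof] requires; near time 0 the clamp is the identity. *)
Lemma bounded_lipschitz_C1 (h : 'rV[R]_n -> R) (x0 : 'rV[R]_n) (l : 'I_n -> K) :
  of_class_C 1 h ->
  bounded_lipschitz (fun p => h (\row_i clamp (x0 0 i) 1 (p (l i)))).
Proof.
move=> [ch Ch].
have dh (i : 'I_n) (y : 'rV[R]_n) : derivable h y (delta_mx 0 i) by have [] := Ch i.
have cdh (i : 'I_n) : continuous (partial i h) by have [_ []] := Ch i.
have [M M0 hM] := box_bounded x0 1 ch.
(* The intermediate points of [mean_value_coord] may leave the unit box, but stay
   within distance 1 + 2 of [x0]. *)
have exN (i : 'I_n) := box_bounded x0 3 (cdh i).
pose N i := sval (cid2 (exN i)).
have N0 i : 0 <= N i by rewrite /N; case: cid2.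
have hN i (y : 'rV[R]_n) : (forall j, `|y 0 j - x0 0 j| <= 3) -> `|partial i h y| <= N i.
  by rewrite /N; case: cid2 => /= ? _; exact.
pose S := \sum_i N i.
have S0 : 0 <= S by exact: sumr_ge0.
exists (M + S); split=> [|p|p q d d0 pq].
- exact: addr_ge0.
- apply: (@le_trans _ _ M); last by rewrite lerDl.
  by apply: hM => j; rewrite mxE clamp_dist.
pose P : 'rV[R]_n := \row_i clamp (x0 0 i) 1 (p (l i)).
pose Q : 'rV[R]_n := \row_i clamp (x0 0 i) 1 (q (l i)).
have [xi xiP ->] := mean_value_coord Q P dh.
apply: (@le_trans _ _ (S * d)); last by rewrite ler_wpM2r// lerDr.
apply: (le_trans (ler_norm_sum _ _ _)); rewrite mulr_suml.
apply: ler_sum => k _; rewrite normrM; apply: ler_pM => //.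
  apply: hN => j.
  have H1 : `|P 0 j - x0 0 j| <= 1 by rewrite mxE clamp_dist.
  have H2 : `|Q 0 j - x0 0 j| <= 1 by rewrite mxE clamp_dist.
  have H3 : `|P 0 j - Q 0 j| <= 2 by move: H1 H2; rewrite !ler_norml; lra.
  have := le_trans (xiP k j) H3; move: H2; rewrite !ler_norml; lra.
by rewrite !mxE; apply: le_trans (clamp_lip _ _ _ _) _; exact: pq.
Qed.

End BoundedLipschitz.

(** * Local solutions of the geodesic equation *)

Section GeodesicEquation.
Local Open Scope classical_set_scope.
Local Open Scope ring_scope.
Variables (R : realType) (n : nat) (G : connection R n).
Hypothesis G_C1 : forall i j k, of_class_C 1 (fun x => G x i j k).

(** The geodesic equation is treated as the first-order system x' = v, v' = - G(v, v). *)
Definition geodesic_rhs (x v : 'rV[R]_n) (i : 'I_n) : R :=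
  - \sum_j \sum_k G x i j k * v 0 j * v 0 k.

(** The state consists of position ([inl]) and velocity ([inr]), both clamped to unit boxes around
    the initial data so that the system is globally Lipschitz. By continuity the solution stays in
    the boxes, with nonzero velocity, for a short time, and there it solves the original system. *)
Lemma geodesic_equation (x0 v0 : 'rV[R]_n) : v0 != 0 ->
  exists2 T : R, 0 < T & exists c v : R -> 'rV[R]_n,
    [/\ c 0 = x0, v 0 = v0 & forall t : R, -T < t < T ->
      [/\ v t != 0,
          forall i, is_derive t (1 : R) (fun s => c s 0 i) (v t 0 i) &
          forall i, is_derive t (1 : R) (fun s => v s 0 i)
            (geodesic_rhs (c t) (v t) i)]].
Proof.
move=> v0_neq0.
pose K : finType := ('I_n + 'I_n)%type.
pose X (p : K -> R) : 'rV[R]_n := \row_i clamp (x0 0 i) 1 (p (inl i)).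
pose V (p : K -> R) : 'rV[R]_n := \row_i clamp (v0 0 i) 1 (p (inr i)).
pose F (p : K -> R) (k : K) : R :=
  match k with inl i => V p 0 i | inr i => geodesic_rhs (X p) (V p) i end.
pose p0 (k : K) : R := match k with inl i => x0 0 i | inr i => v0 0 i end.
have VE i : (fun p => V p 0 i) = (fun p => clamp (v0 0 i) 1 (p (inr i))).
  by apply/funext => p; rewrite mxE.
have F_lip k : bounded_lipschitz (fun p => F p k).
  have V_lip i : bounded_lipschitz (fun p => V p 0 i).
    by rewrite VE; exact: bounded_lipschitz_clamp.
  case: k => i; first exact: V_lip.
  rewrite /F /geodesic_rhs; under eq_fun do rewrite -mulN1r.
  apply: bounded_lipschitzM; first exact: bounded_lipschitz_cst.
  apply: bounded_lipschitz_sum => j; apply: bounded_lipschitz_sum => k.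
  apply: bounded_lipschitzM => //; apply: bounded_lipschitzM => //.
  exact: (bounded_lipschitz_C1 x0 (@inl 'I_n 'I_n : 'I_n -> K) (G_C1 i j k)).
pose M k := sval (cid (F_lip k)).
have M0 k : 0 <= M k by rewrite /M; case: cid => ? [].
have L0 : 0 <= \sum_k M k by exact: sumr_ge0.
have FL (p q : K -> R) (d : R) : (forall j, `|p j - q j| <= d) ->
    forall j, `|F p j - F q j| <= (\sum_k M k) * d.
  move=> pq j; have d0 : 0 <= d by apply: le_trans (pq j).
  apply: (@le_trans _ _ (M j * d)).
    by rewrite /M; case: cid => /= N [_ _]; exact.
  by rewrite ler_wpM2r// (bigD1 j)//= lerDl sumr_ge0.
have [T T0 [u [u0 cu du]]] := picard_lindelof L0 FL p0.
have near0 : \forall t \near (0 : R),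
    (forall k, `|u t k - p0 k| <= 1) /\ \row_i u t (inr i) != 0 :> 'rV[R]_n.
  have /rV0Pn[i vi] := v0_neq0.
  near=> t; split.
    near: t; apply: filter_forall => k.
    have /cvgrPdist_le/(_ 1 ltr01) := cu k 0.
    by rewrite u0; under eq_near do rewrite distrC.
  suff : u t (inr i) != 0.
    by apply: contra_neq => /rowP/(_ i); rewrite !mxE.
  near: t; apply: cvgr_neq0 (cu (inr i) 0) _.
  by rewrite u0.
have [e e0 He] : exists2 e : R, 0 < e & forall t, -e < t < e ->
    (forall k, `|u t k - p0 k| <= 1) /\ \row_i u t (inr i) != 0 :> 'rV[R]_n.
  have /nbhs_ballP[e e0 He] := near0; exists e => // t te; apply: He.
  by rewrite /ball/= sub0r normrN ltr_norml.
exists (Num.min e T); first by rewrite lt_min e0 T0.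
exists (fun t => \row_i u t (inl i)), (fun t => \row_i u t (inr i)).
split.
- by apply/rowP => i; rewrite mxE u0.
- by apply/rowP => i; rewrite mxE u0.
move=> t /andP[t1 t2].
have te : -e < t < e.
  by move: t1 t2; rewrite ltrNl !lt_min ltrNl => /andP[-> _] /andP[-> _].
have tT : -T < t < T.
  by move: t1 t2; rewrite ltrNl !lt_min ![- t < _]ltrNl => /andP[_ ->] /andP[_ ->].
have [u_near v_neq0] := He t te.
have XE : X (u t) = \row_i u t (inl i).
  by apply/rowP => i; rewrite !mxE clamp_id//; exact: (u_near (inl i)).
have VE' : V (u t) = \row_i u t (inr i).
  by apply/rowP => i; rewrite !mxE clamp_id//; exact: (u_near (inr i)).
split=> // i.
  have := du t (inl i) tT; rewrite /F VE'.
  by under [X in _ -> is_derive _ _ X _]eq_fun do rewrite mxE.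
have := du t (inr i) tT; rewrite /F VE' XE.
by under [X in _ -> is_derive _ _ X _]eq_fun do rewrite mxE.
Unshelve. all: by end_near. Qed.
End GeodesicEquation.

(** * Solutions of the system as regular curves *)

Section CurvesFromEquation.
Local Open Scope classical_set_scope.
Local Open Scope ring_scope.
Variables (R : realType) (n : nat).

Lemma is_derive_sum_ord m (f : 'I_m -> R -> R) (t : R) (df : 'I_m -> R) :
  (forall i, is_derive t (1 : R) (f i) (df i)) ->
  is_derive t (1 : R) (fun s => \sum_i f i s) (\sum_i df i).
Proof.
move=> fd; rewrite (_ : (fun _ => _) = \sum_i f i); first exact: is_derive_sum.
by apply/funext => s; rewrite fct_sumE.
Qed.

Lemma is_derive_mul (f h : R -> R) (t df dh : R) :
  is_derive t (1 : R) f df -> is_derive t (1 : R) h dh ->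
  is_derive t (1 : R) (fun s => f s * h s) (df * h t + f t * dh).
Proof.
move=> fd hd; apply: is_derive_eq (is_deriveM fd hd) _.
by rewrite /GRing.scale /=; ring.
Qed.

Lemma derivable_row (c : R -> 'rV[R]_n) (c' : 'rV[R]_n) (t : R) :
  (forall i, is_derive t (1 : R) (fun s => c s 0 i) (c' 0 i)) ->
  derivable c t 1 /\ derive1 c t = c'.
Proof.
move=> dc; have D : derivable c t 1.
  by apply/derivable_mxP => i j; rewrite ord1; have [] := dc j.
split=> //; rewrite derive1E derive_mx//; apply/rowP => j.
by rewrite mxE; have [_ <-] := dc j.
Qed.

Section FromEquation.
Variables (G : connection R n) (T : R) (c v : R -> 'rV[R]_n).
Hypothesis T0 : 0 < T.
Hypothesis G_continuous : forall i j k, continuous (fun x => G x i j k).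
Hypothesis v_neq0 : forall t : R, -T < t < T -> v t != 0.
Hypothesis dc : forall t : R, -T < t < T -> forall i,
  is_derive t (1 : R) (fun s => c s 0 i) (v t 0 i).
Hypothesis dv : forall t : R, -T < t < T -> forall i,
  is_derive t (1 : R) (fun s => v s 0 i) (geodesic_rhs G (c t) (v t) i).

Let I := `]-T, T[%classic.

Let near_I (t : R) : I t -> \forall s \near t, I s.
Proof. by move=> It; apply: near_in_itvoo; exact: It. Qed.

Let I_lt (t : R) : I t -> -T < t < T.
Proof. by rewrite /I /= in_itv. Qed.

Lemma derive1_solution (t : R) : I t -> derivable c t 1 /\ derive1 c t = v t.
Proof. by move=> /I_lt It; apply: derivable_row => i; exact: dc. Qed.

Let near_v (t : R) : I t -> {near t, v =1 derive1 c}.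
Proof.
move=> It; near=> s; have [_ ->//] : derivable c s 1 /\ derive1 c s = v s.
by apply: derive1_solution; near: s; exact: near_I.
Unshelve. all: by end_near. Qed.

Let acc (t : R) : 'rV[R]_n := \row_i geodesic_rhs G (c t) (v t) i.

Lemma derive1_derive1_solution (t : R) : I t ->
  derivable (derive1 c) t 1 /\ derive1 (derive1 c) t = acc t.
Proof.
move=> It; have [D E] : derivable v t 1 /\ derive1 v t = acc t.
  by apply: derivable_row => i; rewrite mxE; apply: dv; exact: I_lt.
split; first by apply: near_eq_derivable D; exact: near_v.
rewrite -E !derive1E; apply: near_eq_derive.
by have := near_v It; apply: filterS => s /= ->.
Qed.

(** The second derivative agrees near each time with [acc], which is continuous because [G], [c] and
    [v] are. *)
Lemma regular_solution : regular_curve I c.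
Proof.
split.
- exact: interval_open.
- exact: interval_is_interval.
- by exists 0; rewrite /I /= in_itv/= oppr_lt0 T0.
move=> t It; have [D1 E1] := derive1_solution It.
have [D2 E2] := derive1_derive1_solution It.
split; [exact: D1|exact: D2| |by rewrite E1; apply: v_neq0; exact: I_lt].
have acc_t : {near t, acc =1 derive1 (derive1 c)}.
  near=> s; have [_ ->//] : derivable (derive1 c) s 1 /\
    derive1 (derive1 c) s = acc s.
  by apply: derive1_derive1_solution; near: s; exact: near_I.
apply: (cvg_trans (near_eq_cvg acc_t)).
rewrite E2; apply: cvg_row => i.
have cvt (u : R -> 'rV[R]_n) (w : 'I_n -> R) j :
    is_derive t (1 : R) (fun s => u s 0 j) (w j) ->
    (fun s => u s 0 j) @ t --> u t 0 j.
  move=> [du _]; apply: differentiable_continuous; exact/derivable1_diffP.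
have ct j : (fun s => c s 0 j) @ t --> c t 0 j.
  by apply: cvt (dc (I_lt It) j).
have vt j : (fun s => v s 0 j) @ t --> v t 0 j.
  by apply: cvt (dv (I_lt It) j).
have cct : c @ t --> c t by exact: cvg_row.
rewrite mxE; under eq_fun do rewrite mxE.
apply: cvgN; apply: cvg_sum_ord => j; apply: cvg_sum_ord => k.
apply: cvgM (vt k); apply: cvgM (vt j).
exact: (continuous_cvg _ (@G_continuous i j k (c t)) cct).
Unshelve. all: by end_near. Qed.

(** As c'' = - G(v, v), the acceleration with respect to [H] is the difference tensor H - G on (v,
    v). Taking H = G shows that the curve is a geodesic; another [H] gives access to the difference
    tensor. *)
Lemma acceleration_solution (H : connection R n) (t : R) : I t ->
  acceleration H c t = \row_i (\sum_j \sum_k H (c t) i j k * v t 0 j * v t 0 k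
                    - \sum_j \sum_k G (c t) i j k * v t 0 j * v t 0 k).
Proof.
move=> It; have [_ E1] := derive1_solution It.
have [_ E2] := derive1_derive1_solution It.
by apply/rowP => i; rewrite /acceleration E2 E1 !mxE addrC.
Qed.

End FromEquation.

(** * Conservation of g(c', c') along geodesics of g *)

Section NullPreserved.
Variables (g : 'rV[R]_n -> 'M[R]_n) (T : R) (c v : R -> 'rV[R]_n).
Hypothesis g_metric : metric g.
Hypothesis g_C1 : forall i j, of_class_C 1 (fun x => g x i j).
Hypothesis dc : forall t : R, -T < t < T -> forall i,
  is_derive t (1 : R) (fun s => c s 0 i) (v t 0 i).
Hypothesis dv : forall t : R, -T < t < T -> forall i,
  is_derive t (1 : R) (fun s => v s 0 i)
    (geodesic_rhs (levi_civita g) (c t) (v t) i).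

Lemma innerE x u w : inner g x u w = \sum_j \sum_k g x j k * u 0 j * w 0 k.
Proof.
rewrite /inner mxE exchange_big/=; apply: eq_bigr => k _.
rewrite !mxE mulr_suml; apply: eq_bigr => j _; ring.
Qed.

(** Metric compatibility turns the derivatives of [g] into two Christoffel terms, [S1] and [S2];
    they cancel the terms that come from v' = - F(v, v). *)
Lemma is_derive_inner (t : R) : -T < t < T ->
  is_derive t (1 : R) (fun s => inner g (c s) (v s) (v s)) 0.
Proof.
move=> tT.
have dgE := ((levi_civitaP (levi_civita g) g_metric).2 erefl).2.
(* The vector F(v, v), that is, the negative of v'. *)
pose B m := \sum_l \sum_j levi_civita g (c t) m l j * v t 0 l * v t 0 j.
have S1 : \sum_j \sum_k (\sum_l (\sum_m levi_civita g (c t) m l j * g (c t) m k) *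
      v t 0 l) * v t 0 j * v t 0 k =
    \sum_m \sum_k g (c t) m k * B m * v t 0 k.
  rewrite exchange_big [RHS]exchange_big/=; apply: eq_bigr => k _.
  rewrite -!mulr_suml; congr (_ * _).
  transitivity (\sum_j \sum_l \sum_m
      g (c t) m k * (levi_civita g (c t) m l j * v t 0 l * v t 0 j)).
    apply: eq_bigr => j _; rewrite mulr_suml; apply: eq_bigr => l _.
    by rewrite !mulr_suml; apply: eq_bigr => m _; ring.
  rewrite exchange_big/=; under eq_bigr => l _ do rewrite exchange_big/=.
  rewrite exchange_big/=; apply: eq_bigr => m _; rewrite /B mulr_sumr.
  by apply: eq_bigr => l _; rewrite mulr_sumr.
have S2 : \sum_j \sum_k (\sum_l (\sum_m levi_civita g (c t) m l k * g (c t) j m) *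
      v t 0 l) * v t 0 j * v t 0 k =
    \sum_j \sum_m g (c t) j m * v t 0 j * B m.
  apply: eq_bigr => j _.
  transitivity (\sum_k \sum_l \sum_m g (c t) j m * v t 0 j *
      (levi_civita g (c t) m l k * v t 0 l * v t 0 k)).
    apply: eq_bigr => k _; rewrite -mulrA mulr_suml; apply: eq_bigr => l _.
    by rewrite !mulr_suml; apply: eq_bigr => m _; ring.
  rewrite exchange_big/=; under eq_bigr => l _ do rewrite exchange_big/=.
  rewrite exchange_big/=; apply: eq_bigr => m _; rewrite /B mulr_sumr.
  by apply: eq_bigr => l _; rewrite mulr_sumr.
have H : is_derive t (1 : R)
    (fun s => \sum_j \sum_k g (c s) j k * v s 0 j * v s 0 k)
    (\sum_j \sum_k (((\sum_l partial l (fun y => g y j k) (c t) * v t 0 l) * v t 0 j +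
      g (c t) j k * - B j) * v t 0 k + g (c t) j k * v t 0 j * - B k)).
  apply: is_derive_sum_ord => j; apply: is_derive_sum_ord => k.
  apply: is_derive_mul; last exact: dv.
  apply: is_derive_mul; last exact: dv.
  exact: (chain_rule (g_C1 j k) (dc tT)).
have E : \sum_j \sum_k (((\sum_l partial l (fun y => g y j k) (c t) * v t 0 l) * v t 0 j +
      g (c t) j k * - B j) * v t 0 k + g (c t) j k * v t 0 j * - B k) =
   \sum_j \sum_k (\sum_l (\sum_m levi_civita g (c t) m l j * g (c t) m k) *
      v t 0 l) * v t 0 j * v t 0 k + \sum_j \sum_k
   (\sum_l (\sum_m levi_civita g (c t) m l k * g (c t) j m) *
      v t 0 l) * v t 0 j * v t 0 k
  - \sum_m \sum_k g (c t) m k * B m * v t 0 k - \sum_j \sum_m g (c t) j m * v t 0 j * B m.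
  rewrite -big_split -!sumrB/=; apply: eq_bigr => j _.
  rewrite -big_split -!sumrB/=; apply: eq_bigr => k _.
  under eq_bigr => l _ do rewrite dgE mulrDl.
  rewrite big_split/=; ring.
rewrite (_ : (fun _ => _) = fun s => \sum_j \sum_k g (c s) j k * v s 0 j * v s 0 k).
  by apply: is_derive_eq H _; rewrite E S1 S2; ring.
by apply/funext => s; rewrite innerE.
Qed.

(** The mean value inequality with derivative bound 0 on [-|t|, |t|]. *)
Lemma inner_const (t : R) : -T < t < T ->
  inner g (c t) (v t) (v t) = inner g (c 0) (v 0) (v 0).
Proof.
move=> /andP[t1 t2].
pose f s := inner g (c s) (v s) (v s) - inner g (c 0) (v 0) (v 0).
have t0 : `|t| < T by rewrite ltr_norml t1 t2.
have fd (s : R) : -`|t| <= s <= `|t| -> is_derive s (1 : R) f 0.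
  move=> /andP[s1 s2]; rewrite -[0]subr0; apply: is_deriveB.
  apply: is_derive_inner; lra.
have f0 : f 0 = 0 by rewrite /f subrr.
have : `|f t| <= `|t| * 0.
  by apply: (norm_le_derive_bound fd _ f0) => [s _|]; rewrite ?normr0// -ler_norml.
by rewrite mulr0 normr_le0 subr_eq0 => /eqP.
Qed.

End NullPreserved.
End CurvesFromEquation.

(** * The difference tensor *)

Section LightConeCompatible.
Local Open Scope classical_set_scope.
Local Open Scope ring_scope.
Variables (R : realType) (n : nat).

(** The geodesic of [g] issued from [x] with velocity [v] remains null, hence is a geodesic of [G].
    Its [G]-acceleration is the difference tensor on the velocity; the factor [a] is the
    proportionality factor at time 0. *)
Lemma light_cone_compatible_null (g : 'rV[R]_n -> 'M[R]_n) (G : connection R n)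
    (x v : 'rV[R]_n) :
  metric g -> (forall i j, of_class_C 1 (fun x => g x i j)) ->
  (forall i j k, of_class_C 1 (fun x => levi_civita g x i j k)) ->
  light_cone_compatible G g -> v != 0 -> inner g x v v = 0 ->
  exists a : R, forall i,
    (v *m (G x i - levi_civita g x i) *m v^T) 0 0 = a * v 0 i.
Proof.
move=> mg g1 F1 compat v0 vnull.
have Fc i j k := of_class_C_continuous (F1 i j k).
have [T T0 [c [w [cx wv sol]]]] := geodesic_equation F1 x v0.
have w_neq0 (t : R) : -T < t < T -> w t != 0 by move=> /sol[].
have dc (t : R) : -T < t < T -> forall i,
  is_derive t (1 : R) (fun s => c s 0 i) (w t 0 i) by move=> /sol[].
have dw (t : R) : -T < t < T -> forall i, is_derive t (1 : R) (fun s => w s 0 i)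
    (geodesic_rhs (levi_civita g) (c t) (w t) i) by move=> /sol[].
have regc := regular_solution T0 Fc w_neq0 dc dw.
have accE := acceleration_solution dc dw.
have It (t : R) : `]-T, T[%classic t -> -T < t < T by rewrite /= in_itv.
have [|_ [a ca]] := compat `]-T, T[%classic c.
  split.
    split=> //; exists (fun=> 0) => t tI; rewrite accE// scale0r.
    by apply/rowP => i; rewrite !mxE subrr.
  move=> t tI; have [_ ->] := derive1_solution dc tI.
  by rewrite (inner_const mg g1 dc dw (It _ tI)) cx wv.
have I0 : `]-T, T[%classic (0 : R) by rewrite /= in_itv/= oppr_lt0 T0.
exists (a 0) => i; rewrite quadE; have := ca 0 I0; rewrite accE//.
have [_ ->] := derive1_solution dc I0.
move=> /rowP/(_ i); rewrite !mxE cx wv => <-.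
rewrite /quad -sumrB; apply: eq_bigr => j _.
by rewrite -sumrB; apply: eq_bigr => k _; rewrite !mxE; ring.
Qed.

(** * Recovering phi and eta from two traces of the difference tensor *)

Section Traces.
Variables (g : 'rV[R]_n -> 'M[R]_n) (D : connection R n).

Definition trace_contraction (x : 'rV[R]_n) (k : 'I_n) : R := \sum_i D x i i k.

(** The metric trace of [D] over the two lower indices, with the remaining upper index lowered. *)
Definition metric_contraction (x : 'rV[R]_n) (k : 'I_n) : R :=
  \sum_i g x k i * \sum_a \sum_b invmx (g x) a b * D x i a b.

Lemma of_class_C_trace_contraction m :
  (forall i j k, of_class_C m (fun x => D x i j k)) ->
  forall k, of_class_C m (trace_contraction ^~ k).
Proof. by move=> Dm k; apply: of_class_C_sum. Qed.

Lemma of_class_C_metric_contraction m : metric g ->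
  (forall i j, of_class_C m (fun x => g x i j)) ->
  (forall i j k, of_class_C m (fun x => D x i j k)) ->
  forall k, of_class_C m (metric_contraction ^~ k).
Proof.
move=> mg gm Dm k.
have gV : forall a b, of_class_C m (fun x => invmx (g x) a b).
  by apply: of_class_C_invmx => // x; have [] := mg x.
apply: of_class_C_sum => i _; apply: of_class_CM => //.
apply: of_class_C_sum => a _; apply: of_class_C_sum => b _.
exact: of_class_CM.
Qed.

Variables (x : 'rV[R]_n) (phi eta : 'I_n -> R).
Hypothesis g_sym : (g x)^T = g x.
Hypothesis g_unit : g x \in unitmx.
Hypothesis DE : forall i j k,
  D x i j k = phi i * g x j k + eta j * (i == k)%:R + eta k * (i == j)%:R.

Let gVg i j : \sum_l invmx (g x) i l * g x l j = (i == j)%:R.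
Proof. by have /matrixP/(_ i j) := mulVmx g_unit; rewrite !mxE. Qed.

Let ggV i j : \sum_l g x i l * invmx (g x) l j = (i == j)%:R.
Proof. by have /matrixP/(_ i j) := mulmxV g_unit; rewrite !mxE. Qed.

Let gC i j : g x i j = g x j i.
Proof. by have /matrixP/(_ j i) := g_sym; rewrite mxE. Qed.

Let gVC i j : invmx (g x) i j = invmx (g x) j i.
Proof. by have /matrixP/(_ j i) := trmx_inv (g x); rewrite g_sym mxE. Qed.

Let sum_deltaC (a : 'I_n) (f : 'I_n -> R) : \sum_i f i * (a == i)%:R = f a.
Proof. by under eq_bigr => i _ do rewrite eq_sym; exact: sum_delta. Qed.

(** The three summands of [DE] contribute phi_k, eta_k and n eta_k. *)
Lemma trace_contractionE k :
  trace_contraction x k = \sum_i g x k i * phi i + n.+1%:R * eta k.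
Proof.
rewrite /trace_contraction; under eq_bigr => i _ do rewrite DE eqxx mulr1.
rewrite !big_split/= sum_delta sumr_const card_ord -natr1 mulrDl mul1r.
rewrite -[eta k *+ n]mulr_natl -addrA [eta k + _]addrC; congr (_ + _).
by apply: eq_bigr => i _; rewrite gC mulrC.
Qed.

(** The metric term contributes g^ab g_ab = n times phi; each eta term gives g^ia eta_a, which
    lowering turns back into eta_k. *)
Lemma metric_contractionE k :
  metric_contraction x k = n%:R * \sum_i g x k i * phi i + 2 * eta k.
Proof.
have E i : \sum_a \sum_b invmx (g x) a b * D x i a b =
    n%:R * phi i + 2 * \sum_a invmx (g x) i a * eta a.
  transitivity (\sum_a (\sum_b invmx (g x) a b * g x b a) * phi i +
      (\sum_a invmx (g x) a i * eta a + \sum_a \sum_b invmx (g x) a b * eta b * (i == a)%:R)).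
    rewrite -!big_split/=; apply: eq_bigr => a _.
    rewrite -(sum_deltaC i (fun b => invmx (g x) a b * eta a)) mulr_suml.
    rewrite -!big_split/=; apply: eq_bigr => b _.
    by rewrite DE (gC b a); ring.
  under eq_bigr => a _ do rewrite gVg eqxx mul1r.
  rewrite sumr_const card_ord mulr_natl; congr (_ + _).
  rewrite [X in _ + X]exchange_big/=.
  under [X in _ + X]eq_bigr => b _ do rewrite (sum_deltaC i (fun a => invmx (g x) a b * eta b)).
  under eq_bigr => a _ do rewrite gVC.
  by rewrite mulr_natl mulr2n.
rewrite /metric_contraction; under eq_bigr => i _ do rewrite E mulrDr.
rewrite big_split/= mulr_sumr; congr (_ + _).
  by apply: eq_bigr => i _; ring.
transitivity (2 * \sum_a (\sum_i g x k i * invmx (g x) i a) * eta a).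
  transitivity (\sum_i \sum_a 2 * (g x k i * invmx (g x) i a) * eta a).
    by apply: eq_bigr => i _; rewrite !mulr_sumr; apply: eq_bigr => a _; ring.
  rewrite exchange_big mulr_sumr/=; apply: eq_bigr => a _.
  by rewrite mulr_suml mulr_sumr; apply: eq_bigr => i _; ring.
under eq_bigr => a _ do rewrite ggV mulrC.
by rewrite sum_deltaC.
Qed.

(** The pointwise algebra yields phi with an upper index, whereas the 1-form sought has a lower one;
    this passes between them. *)
Lemma raise_lower (p : 'rV[R]_n -> 'rV[R]_n) i :
  (forall k, p x 0 k = \sum_j g x k j * phi j) -> raise g p x i = phi i.
Proof.
move=> pE; rewrite /raise; under eq_bigr => j _ do rewrite pE mulr_sumr.
rewrite exchange_big/=; under eq_bigr => l _.
  under eq_bigr => j _ do rewrite mulrA.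
  rewrite -mulr_suml gVg mulrC.
  over.
exact: sum_deltaC.
Qed.

End Traces.

(** Treats finite and infinite smoothness at once: [Q k] collects what is known at degree [k]. *)
Lemma smooth_of_class_C (r : option nat) (f : 'rV[R]_n -> R) (Q : nat -> Prop) :
  (if r is Some k then Q k else forall k, Q k) ->
  (forall k, Q k -> of_class_C k f) -> smooth r f.
Proof. by case: r => [k|] Qr Qf; [exact: Qf|move=> k; exact: Qf]. Qed.

End LightConeCompatible.

(** * Assembling the global formula with smooth 1-forms *)

Unset Implicit Arguments.

Theorem theorem1 (R : realType) (n : nat) (hn : (3 <= n)%N)
    (r : option nat) (hr : r != Some 0%N)
    (g : 'rV[R]_n -> 'M[R]_n) (G : connection R n)
    (g_smooth : forall i j, smooth (omap succn r) (fun x => g x i j))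
    (g_metric : metric g)
    (g_indefinite : indefinite_signature g)
    (G_smooth : forall i j k, smooth r (fun x => G x i j k))
    (G_symmetric : symmetric_connection G)
    (G_g_compatible : light_cone_compatible G g) :
  exists phi eta : 'rV[R]_n -> 'rV[R]_n,
    [/\ forall i, smooth r (fun x => phi x 0 i),
        forall i, smooth r (fun x => eta x 0 i) &
        forall x i j k,
          G x i j k = levi_civita g x i j k + raise g phi x i * g x j k
                      + eta x 0 j * (i == k)%:R + eta x 0 k * (i == j)%:R].
Proof.
have F_smooth := smooth_levi_civita g_metric g_smooth.
have g1 i j : of_class_C 1 (fun x => g x i j).
  (* The degree [omap succn r] is never [Some 0]. *)
  by apply: smooth_of_class_C1 (g_smooth i j); case: (r).
have F1 i j k : of_class_C 1 (fun x => levi_civita g x i j k).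
  exact: smooth_of_class_C1 hr (F_smooth i j k).
have [F_sym _] := (levi_civitaP (levi_civita g) g_metric).2 erefl.
have [p pn g_sig] := g_indefinite.
pose D : connection R n := fun x i => G x i - levi_civita g x i.
have DGF x i j k : D x i j k = G x i j k + - levi_civita g x i j k.
  by rewrite /D mxE [X in _ + X]mxE.
have DE x : exists phi eta : 'I_n -> R, forall i j k,
    D x i j k = phi i * g x j k + eta j * (i == k)%:R + eta k * (i == j)%:R.
  apply: (null_cone pn (g_sig x)) => [i|v vnull i j].
    by rewrite /D linearB/= G_symmetric F_sym.
  (* A regular curve cannot start with velocity 0, but for v = 0 the identity is trivial. *)
  have [->|v0] := eqVneq v 0; first by rewrite !mxE !mul0r.
  have [a aE] := light_cone_compatible_null g_metric g1 F1 G_g_compatible v0 vnull.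
  by rewrite /D !aE; ring.
(* This is n (n + 1) - 2, factored so that it is visibly nonzero for n >= 3. *)
pose d : R := (n.+2)%:R * (n.-1)%:R.
have d0 : d != 0.
  by rewrite /d mulf_neq0 ?pnatr_eq0//; move: hn; case: (n) => [|[]].
pose A := trace_contraction D; pose B := metric_contraction g D.
have AB_smooth a b i : smooth r (fun x => a * A x i + b * B x i).
  (* The forms provided by [DE] are chosen separately at each point and carry no regularity; the
     traces are built from [g], its inverse, [G] and F, and inherit theirs. *)
  apply: (@smooth_of_class_C _ _ _ _ (fun k =>
    [/\ forall i j, of_class_C k (fun x => g x i j),
        forall i j l, of_class_C k (fun x => G x i j l) &
        forall i j l, of_class_C k (fun x => levi_civita g x i j l)])).
    move: g_smooth G_smooth F_smooth; case: (r) => [k|] gs Gs Fs.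
      by split=> // j l; apply: of_class_CS; exact: gs.
    by move=> k; split=> *; [exact: gs|exact: Gs|exact: Fs].
  move=> k [gk Gk Fk].
  have Dk u j l : of_class_C k (fun x => D x u j l).
    under eq_fun do rewrite DGF.
    by apply: of_class_CD => //; exact: of_class_CN.
  apply: of_class_CD; (apply: of_class_CM; first exact: of_class_C_cst).
    exact: of_class_C_trace_contraction.
  exact: of_class_C_metric_contraction.
(* Cramer's rule for A = phi + (n + 1) eta, B = n phi + 2 eta: d phi = - 2 A + (n + 1) B and d eta =
   n A - B. *)
exists (fun x => \row_k (- 2 / d * A x k + n.+1%:R / d * B x k)),
  (fun x => \row_k (n%:R / d * A x k + - 1 / d * B x k)).
split=> [i|i|x i j k]; first by under eq_fun do rewrite mxE; exact: AB_smooth.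
  by under eq_fun do rewrite mxE; exact: AB_smooth.
have [phi [eta Dx]] := DE x; have [gT gu] := g_metric x.
have AE := trace_contractionE gT Dx.
have BE := metric_contractionE gT gu Dx.
have nE : n = (n.-1).+1 by move: hn; case: (n).
have dE : n%:R * n.+1%:R - 2 = d.
  by rewrite /d [in LHS]nE -addn2 -!natr1 natrD [in RHS]nE -natr1; ring.
(* The determinant in the form of the side condition left by [field]. *)
have dE0 : n%:R * (1 + n%:R) - 2 != 0 :> R by rewrite [1 + _]addrC natr1 dE.
rewrite (@raise_lower _ _ _ _ phi) => [|//|l].
  have -> : G x i j k = levi_civita g x i j k + D x i j k.
    by rewrite DGF; ring.
  rewrite Dx !addrA; congr (_ + _ * _ + _ * _); rewrite !mxE /A /B AE BE -dE;
    field; exact: dE0.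
by rewrite mxE /A /B AE BE -dE; field; exact: dE0.
Qed.
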